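(* Let $T>0$, let $L\in\mathcal{M}_d(\mathbb{C})$ be unitary, $\tilde H\in\mathcal{M}_d(\mathbb{C})$ with $\tilde H=\tilde H^\dagger$, let $A$ be a pairwise interaction operator with kernel $a$, and let $\rho_0\in\mathcal{S}(\mathbb{H})$. For a graphon $\mathrm{W}$ consider the system, indexed by $u\in I=[0,1]$, on $[0,T]$, $$\mathrm{d}\gamma_t^{u} = -\mathrm{i}\Big[\tilde{H} + \int_{0}^{1}\mathrm{W}(u,v)A^{\mathbb{E}[\gamma_{t-}^{v}]}\,\mathrm{d}v,\ \gamma_{t-}^{u} \Big]\mathrm{d}t+ \Big(L\gamma_{t-}^{u}L^{\dagger} - \gamma_{t-}^{u}\Big)\mathrm{d}N_t^{u},\qquad \gamma_0^u=\rho_0.$$ Let $\tilde\gamma=(\tilde\gamma^u)_{u\in I}$ and $\hat\gamma=(\hat\gamma^u)_{u\in I}$ be the solutions of this system associated with graphons $\mathrm{W}=\tilde{\mathrm{W}}$ and $\mathrm{W}=\hat{\mathrm{W}}$ respectively, with the same initial conditions and driven by the same Poisson processes $(N^u)_{u\in I}$. Then there exists a constant $C=C(T,\|\tilde H\|,\|A\|,\|L\|)$ such that $$\mathbb{E}\Big[\int_{I}\sup_{t\in[0,T]}\big\|\tilde\gamma_t^u-\hat\gamma_t^u\big\|^2\,\mathrm{d}u\Big]\le C\,\|\tilde{\mathrm{W}}-\hat{\mathrm{W}}\|_{\square}.$$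
   Context: The dimension $d\ge 1$ is fixed; $\mathfrak{X}=\{1,\dots,d\}$ with counting measure and $\mathbb{H}=L^2(\mathfrak{X};\mathbb{C})\cong\mathbb{C}^d$. $\mathcal{S}(\mathbb{H})=\{\rho\in\mathcal{M}_d(\mathbb{C}):\rho\ge0,\ \mathrm{tr}(\rho)=1,\ \rho=\rho^\dagger\}$ is the set of density matrices; $^\dagger$ is the adjoint, $[X,Y]=XY-YX$, and $\|O\|=\sqrt{\mathrm{tr}(OO^\dagger)}$ is the Frobenius norm. A graphon is a symmetric measurable function $\mathrm{W}:I^2\to[0,1]$, $I=[0,1]$. A kernel is a bounded symmetric measurable function $\mathrm{W}:I^2\to\mathbb{R}$, and its cut norm is $\|\mathrm{W}\|_{\square}=\sup_{B_1,B_2}\big|\int_{B_1\times B_2}\mathrm{W}(u,v)\,\mathrm{d}u\,\mathrm{d}v\big|$, the supremum being over Borel sets $B_1,B_2\subset I$. The pairwise interaction operator $A:L^2(\mathfrak{X}^2;\mathbb{C})\to L^2(\mathfrak{X}^2;\mathbb{C})$ is $Af(x,y)=\sum_{\tilde x,\tilde y\in\mathfrak{X}}a(x,y;\tilde x,\tilde y)f(\tilde x,\tilde y)$, where the kernel $a$ satisfies $a(x,y;\tilde x,\tilde y)=a(y,x;\tilde y,\tilde x)$ and $a(x,y;\tilde x,\tilde y)=\overline{a(\tilde x,\tilde y;x,y)}$. For $\rho\in\mathcal{S}(\mathbb{H})$, with matrix entries $\rho(y,y')$, the matrix $A^\rho\in\mathcal{M}_d(\mathbb{C})$ has entries $A^{\rho}(x,x')=\sum_{y,y'\in\mathfrak{X}}a(x,y;x',y')\overline{\rho(y,y')}$.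 $(N^u)_{u\in I}$ is a family of Poisson processes of intensity one on a filtered probability space satisfying the usual conditions (each a Poisson process with respect to the filtration). A solution of the system is a family $(\gamma^u)_{u\in I}$ of càdlàg adapted $\mathcal{S}(\mathbb{H})$-valued processes on $[0,T]$ satisfying the integrated equation for every $u\in I$, with $(t,v)\mapsto\mathbb{E}[\gamma^v_{t-}]$ measurable (the system is well posed with $\mathcal{S}(\mathbb{H})$-valued solutions). It is understood that the measurability in $(u,\omega)$ is such that the integral over $u$ in the conclusion is meaningful and may be interchanged with the expectation. *)

(* Defs.v *)
(* Complex numbers are R[i] for R : realType.  Times and graphon labels range
   over R; the hypotheses constrain them only on the relevant intervals. *)
From HB Require Import structures.
From mathcomp Require Import all_boot all_order all_algebra.
From mathcomp Require Import spectral complex.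
From mathcomp Require Import all_classical all_reals all_analysis.
From mathcomp Require Import measurable_realfun.

Set Implicit Arguments.
Unset Strict Implicit.
Unset Printing Implicit Defensive.

Import Order.TTheory GRing.Theory Num.Theory numFieldNormedType.Exports.

Local Open Scope classical_set_scope.
Local Open Scope ring_scope.
Local Open Scope sesquilinear_scope.

Definition unit_itv (R : realType) : set R := `[0, 1]%classic.
Arguments unit_itv {R}.

Definition frobnorm (R : realType) (m n : nat) (A : 'M[R[i]]_(m, n)) : R :=
  Num.sqrt (complex.Re (\tr (A *m A^t*))).

Definition commutator (R : realType) (d : nat) (X Y : 'M[R[i]]_d) :
    'M[R[i]]_d :=
  X *m Y - Y *m X.

Definition density (R : realType) (d : nat) : set 'M[R[i]]_d :=
  [set rho | [/\ forall v : 'cV[R[i]]_d, 0 <= (v^t* *m rho *m v) 0 0,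
                 \tr rho = 1 & rho = rho^t*]].

(* Entrywise integral; real and imaginary parts are integrated separately. *)
Definition mx_integral (R : realType) (d : nat) (disp : measure_display)
    (X : measurableType disp) (mu : {measure set X -> \bar R}) (D : set X)
    (f : X -> 'M[R[i]]_d) : 'M[R[i]]_d :=
  \matrix_(i, j) (Complex (Rintegral mu D (fun x => complex.Re (f x i j)))
                          (Rintegral mu D (fun x => complex.Im (f x i j)))).

Definition interaction_kernel (R : realType) (d : nat)
    (a : 'I_d -> 'I_d -> 'I_d -> 'I_d -> R[i]) : Prop :=
  forall x y x' y',
    a x y x' y' = a y x y' x' /\ a x y x' y' = Num.conj (a x' y' x y).

(* Functions on {1..d}^2 are represented by d x d matrices. *)
Definition interaction_op (R : realType) (d : nat)
    (a : 'I_d -> 'I_d -> 'I_d -> 'I_d -> R[i]) (f : 'M[R[i]]_d) : 'M[R[i]]_d :=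
  \matrix_(x, y) \sum_x' \sum_y' a x y x' y' * f x' y'.

(* Frobenius norm of the d^2 x d^2 matrix of the operator A. *)
Definition interaction_norm (R : realType) (d : nat)
    (a : 'I_d -> 'I_d -> 'I_d -> 'I_d -> R[i]) : R :=
  frobnorm (lin_mx (interaction_op a)).

Definition mean_field (R : realType) (d : nat)
    (a : 'I_d -> 'I_d -> 'I_d -> 'I_d -> R[i]) (rho : 'M[R[i]]_d) :
    'M[R[i]]_d :=
  \matrix_(x, x') \sum_y \sum_y' a x y x' y' * Num.conj (rho y y').

Record graphon (R : realType) (W : R -> R -> R) : Prop := Graphon {
  graphon_measurable :
    measurable_fun (unit_itv `*` unit_itv) (fun p : R * R => W p.1 p.2) ;
  graphon_sym : forall u v, unit_itv u -> unit_itv v -> W u v = W v u ;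
  graphon_itv : forall u v, unit_itv u -> unit_itv v -> 0 <= W u v <= 1 }.

Definition cut_norm (R : realType) (W : R -> R -> R) : \bar R :=
  ereal_sup [set x | exists B1 B2 : set R,
    [/\ measurable B1 /\ B1 `<=` unit_itv, measurable B2 /\ B2 `<=` unit_itv &
        x = `| \int[(lebesgue_measure \x lebesgue_measure)%E]_(p in B1 `*` B2)
               (W p.1 p.2)%:E |%E]].

(* R[i] carries no library topology, so limits of matrices are taken in the
   Frobenius distance. *)
Definition mx_cvg_to (R : realType) (d : nat) (G : set_system R)
    (f : R -> 'M[R[i]]_d) (l : 'M[R[i]]_d) : Prop :=
  frobnorm (f s - l) @[s --> G] --> (0 : R).

(* f(t-) for t > 0, with the convention f(0-) = f(0). *)
Definition left_lim (R : realType) (d : nat) (f : R -> 'M[R[i]]_d) (t : R) :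
    'M[R[i]]_d :=
  if 0 < t then xget 0 [set l | mx_cvg_to t^'- f l] else f t.

Definition cadlag (R : realType) (d : nat) (T : R) (f : R -> 'M[R[i]]_d) :
    Prop :=
  (forall t, 0 <= t < T -> mx_cvg_to t^'+ f (f t)) /\
  (forall t, 0 < t <= T -> exists l, mx_cvg_to t^'- f l).

Record usual_filtration (R : realType) (disp : measure_display)
    (Omega : measurableType disp) (P : probability Omega R)
    (F : R -> set (set Omega)) : Prop := UsualFiltration {
  filtration_sigma : forall t, 0 <= t -> sigma_algebra setT (F t) ;
  filtration_sub : forall t, 0 <= t -> F t `<=` measurable ;
  filtration_mono : forall s t, 0 <= s -> s <= t -> F s `<=` F t ;
  filtration_right : forall t, 0 <= t ->
    \bigcap_(s in [set s | t < s]) F s `<=` F t ;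
  filtration_complete : P.-negligible `<=` F 0 }.

Definition increment (R : realType) (Omega : Type) (N : R -> Omega -> nat)
    (s t : R) (w : Omega) : R :=
  (N t w)%:R - (N s w)%:R.

(* Poisson process of intensity one with respect to F: an adapted,
   integer-valued, cadlag process started at 0 whose increments over ]s, t] are
   independent of F s and Poisson distributed with mean t - s. *)
Record poisson_process (R : realType) (disp : measure_display)
    (Omega : measurableType disp) (P : probability Omega R)
    (F : R -> set (set Omega)) (N : R -> Omega -> nat) : Prop :=
  PoissonProcess {
  poisson_adapted : forall t, 0 <= t -> forall k, F t [set w | N t w = k] ;
  poisson_right : forall w t, 0 <= t ->
    ((N s w)%:R : R) @[s --> t^'+] --> ((N t w)%:R : R) ;
  poisson_left : forall w t, 0 < t ->
    cvg (((N s w)%:R : R) @[s --> t^'-]) ;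
  poisson_start : {ae P, forall w, N 0 w = 0%N} ;
  poisson_indep : forall s t, 0 <= s -> s < t ->
    forall (A : set Omega) (D : set R), F s A -> measurable D ->
    P (A `&` increment N s t @^-1` D) =
      (P A * P (increment N s t @^-1` D))%E ;
  poisson_distr : forall s t, 0 <= s -> s < t -> forall k : nat,
    P (increment N s t @^-1` [set k%:R]) = (poisson_pmf (t - s) k)%:E }.

(* The integral over ]0, t] against the pure-jump path of N, i.e. the sum over
   its finitely many jump times s of (N_s - N_{s-}) f(s). *)
Definition jump_integral (R : realType) (d : nat) (n : R -> nat)
    (f : R -> 'M[R[i]]_d) (t : R) : 'M[R[i]]_d :=
  \sum_(s \in `]0, t]%classic)
    Complex ((n s)%:R - lim (((n r)%:R : R) @[r --> s^'-])) 0 *: f s.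

(* E[gamma^v_{t-}] *)
Definition mean_left (R : realType) (d : nat) (disp : measure_display)
    (Omega : measurableType disp) (P : probability Omega R)
    (gamma : R -> R -> Omega -> 'M[R[i]]_d) (t v : R) : 'M[R[i]]_d :=
  mx_integral P setT (fun w => left_lim (fun s => gamma v s w) t).

Definition effective_hamiltonian (R : realType) (d : nat)
    (disp : measure_display) (Omega : measurableType disp)
    (P : probability Omega R) (H : 'M[R[i]]_d)
    (a : 'I_d -> 'I_d -> 'I_d -> 'I_d -> R[i]) (W : R -> R -> R)
    (gamma : R -> R -> Omega -> 'M[R[i]]_d) (u t : R) : 'M[R[i]]_d :=
  H + mx_integral lebesgue_measure unit_itv
        (fun v => Complex (W u v) 0 *: mean_field a (mean_left P gamma t v)).

(* gamma u t w stands for gamma^u_t(w), with u in [0, 1] and t in [0, T]. *)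
Record solution (R : realType) (d : nat) (disp : measure_display)
    (Omega : measurableType disp) (P : probability Omega R)
    (F : R -> set (set Omega)) (N : R -> R -> Omega -> nat) (T : R)
    (L H : 'M[R[i]]_d) (a : 'I_d -> 'I_d -> 'I_d -> 'I_d -> R[i])
    (rho0 : 'M[R[i]]_d) (W : R -> R -> R)
    (gamma : R -> R -> Omega -> 'M[R[i]]_d) : Prop := Solution {
  solution_adapted : forall u t, unit_itv u -> 0 <= t <= T ->
    forall i j (D : set R), measurable D ->
    F t [set w | D (complex.Re (gamma u t w i j))] /\
    F t [set w | D (complex.Im (gamma u t w i j))] ;
  solution_cadlag : forall u w, unit_itv u -> cadlag T (fun t => gamma u t w) ;
  solution_density : forall u t w, unit_itv u -> 0 <= t <= T ->
    density (gamma u t w) ;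
  solution_mean_measurable : forall i j,
    measurable_fun (`[0, T]%classic `*` unit_itv)
      (fun p : R * R => complex.Re (mean_left P gamma p.1 p.2 i j)) /\
    measurable_fun (`[0, T]%classic `*` unit_itv)
      (fun p : R * R => complex.Im (mean_left P gamma p.1 p.2 i j)) ;
  solution_eq : forall u, unit_itv u ->
    {ae P, forall w, forall t, 0 <= t <= T ->
      gamma u t w =
        rho0
        + mx_integral lebesgue_measure `[0, t]%classic (fun s =>
            Complex 0 (-1) *:
              commutator (effective_hamiltonian P H a W gamma u s)
                         (left_lim (fun r => gamma u r w) s))
        + jump_integral (fun s => N u s w) (fun s =>
            L *m left_lim (fun r => gamma u r w) s *m L^t*
            - left_lim (fun r => gamma u r w) s) t} }.

Definition sup_sqdist (R : realType) (d : nat) (Omega : Type) (T : R)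
    (g h : R -> R -> Omega -> 'M[R[i]]_d) (u : R) (w : Omega) : \bar R :=
  ereal_sup [set (frobnorm (g u t w - h u t w) ^+ 2)%:E | t in `[0, T]%classic].

(* Both iterated integrals of f over [0, 1] x Omega are those of measurable
   functions, and they agree.  Joint measurability of f is deliberately not
   assumed, as it can fail for a continuum of driving processes. *)
Record exchangeable_integral (R : realType) (disp : measure_display)
    (Omega : measurableType disp) (P : probability Omega R)
    (f : R -> Omega -> \bar R) : Prop := ExchangeableIntegral {
  exchangeable_meas_u :
    {ae P, forall w, measurable_fun unit_itv (fun u => f u w)} ;
  exchangeable_meas_int_u : measurable_fun setT
    (fun w => \int[lebesgue_measure]_(u in unit_itv) f u w)%E ;
  exchangeable_meas_w :
    forall u, unit_itv u -> measurable_fun setT (f u) ;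
  exchangeable_meas_int_w : measurable_fun unit_itv
    (fun u => \int[P]_w f u w)%E ;
  exchangeable_eq :
    (\int[P]_w \int[lebesgue_measure]_(u in unit_itv) f u w =
     \int[lebesgue_measure]_(u in unit_itv) \int[P]_w f u w)%E }.

(* Main.v *)
Require Import Defs.
From HB Require Import structures.
From mathcomp Require Import all_boot all_order all_algebra.
From mathcomp Require Import spectral complex.
From mathcomp Require Import all_classical all_reals all_analysis.
From mathcomp Require Import measurable_realfun.
From mathcomp Require Import ring lra.

Import Order.TTheory GRing.Theory Num.Theory numFieldNormedType.Exports.

Local Open Scope classical_set_scope.
Local Open Scope ring_scope.
Local Open Scope sesquilinear_scope.

Set Implicit Arguments.
Unset Strict Implicit.
Unset Printing Implicit Defensive.

(** The stability estimate rests on one observation: a jump of the driving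
    Poisson process replaces the left limit [X] of the difference of the two
    solutions by [L X L^t*], and conjugation by the unitary matrix [L] preserves
    the Frobenius norm.  Hence the noise never increases the distance between
    the two paths, and the distance is controlled by the drifts alone
    ([unitary_jump_bound]).  This needs jumps of size one, which a Poisson process
    has almost surely ([simple_jumps]).

    The drift is the commutator of a Hamiltonian with the left limit of the
    path.  The difference of the two drifts is therefore bounded by a constant
    times the present distance plus a constant times the difference of the two
    Hamiltonians.  The latter involves the solutions only through their
    expectations, so it is deterministic; Gronwall's inequality along a single
    path gives a bound, uniform in time, by the time integral of a deterministic
    function [forcing u] ([path_bound]).

    The forcing splits into two terms.  One is [total_gap], the integral over all
    labels of the distance between the mean states; the other, [graphon_gap],
    integrates the mean-field matrices of the second solution against the
    difference of the graphons.  Since those matrices are bounded, a bang-bang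
    argument (the extremal weights are indicator functions of the sets where a
    partial integral is positive or negative) bounds the label integral of
    [graphon_gap] by a constant times the cut norm ([cut_weight],
    [graphon_gap_cut]).  Taking expectations in the path estimate and
    integrating over the labels gives a second Gronwall inequality, now for
    [total_gap] ([total_gap_le]).

    The path estimate is linear in the distance whereas the theorem asks for its
    square; density matrices are bounded, so the square of the distance is at
    most a constant times the distance, and the bound stays linear in the cut
    norm ([sup_sqdist_le], [graphon_stability]). *)

(** * Norms of complex matrices *)

Section complex1norm.
Variable R : realType.
Implicit Types z w : R[i].

(** The sum norm is preferred to the modulus because real and imaginary parts
    are integrated separately; like the modulus it is submultiplicative. *)
Definition cnorm1 z : R := `|complex.Re z| + `|complex.Im z|.

Lemma ReD z w : complex.Re (z + w) = complex.Re z + complex.Re w.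
Proof. by case: z w => [? ?] []. Qed.
Lemma ImD z w : complex.Im (z + w) = complex.Im z + complex.Im w.
Proof. by case: z w => [? ?] []. Qed.
Lemma ReN z : complex.Re (- z) = - complex.Re z.
Proof. by case: z. Qed.
Lemma ImN z : complex.Im (- z) = - complex.Im z.
Proof. by case: z. Qed.
Lemma ReM z w : complex.Re (z * w) =
  complex.Re z * complex.Re w - complex.Im z * complex.Im w.
Proof. by case: z w => [? ?] []. Qed.
Lemma ImM z w : complex.Im (z * w) =
  complex.Re z * complex.Im w + complex.Im z * complex.Re w.
Proof. by case: z w => [? ?] []. Qed.
Lemma ReC z : complex.Re (Num.conj z) = complex.Re z.
Proof. by case: z. Qed.
Lemma ImC z : complex.Im (Num.conj z) = - complex.Im z.
Proof. by case: z. Qed.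
Lemma Re_sum I (r : seq I) (Q : pred I) (F : I -> R[i]) :
  complex.Re (\sum_(k <- r | Q k) F k) = \sum_(k <- r | Q k) complex.Re (F k).
Proof. exact: (big_morph _ ReD). Qed.
Lemma Im_sum I (r : seq I) (Q : pred I) (F : I -> R[i]) :
  complex.Im (\sum_(k <- r | Q k) F k) = \sum_(k <- r | Q k) complex.Im (F k).
Proof. exact: (big_morph _ ImD). Qed.

Lemma cnorm1_ge0 z : 0 <= cnorm1 z. Proof. exact: addr_ge0. Qed.
Lemma cnorm10 : cnorm1 0 = 0. Proof. by rewrite /cnorm1 /= !normr0 addr0. Qed.
Lemma cnorm1D z w : cnorm1 (z + w) <= cnorm1 z + cnorm1 w.
Proof.
by rewrite /cnorm1 ReD ImD addrACA lerD ?ler_normD.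
Qed.
Lemma cnorm1N z : cnorm1 (- z) = cnorm1 z.
Proof. by rewrite /cnorm1 ReN ImN !normrN. Qed.
Lemma cnorm1C z : cnorm1 (Num.conj z) = cnorm1 z.
Proof. by rewrite /cnorm1 ReC ImC normrN. Qed.
Lemma cnorm1M z w : cnorm1 (z * w) <= cnorm1 z * cnorm1 w.
Proof.
rewrite /cnorm1 ReM ImM mulrDl !mulrDr -!normrM.
rewrite [leRHS](_ : _ = (`|complex.Re z * complex.Re w|
  + `|complex.Im z * complex.Im w|)
  + (`|complex.Re z * complex.Im w| + `|complex.Im z * complex.Re w|)); last by ring.
rewrite lerD ?ler_normD//.
by rewrite -[X in _ <= _ + X]normrN ler_normD.
Qed.
Lemma cnorm1_sum I (r : seq I) (Q : pred I) (F : I -> R[i]) :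
  cnorm1 (\sum_(k <- r | Q k) F k) <= \sum_(k <- r | Q k) cnorm1 (F k).
Proof.
elim/big_ind2 : _ => [|x1 y1 x2 y2 h1 h2|//]; first by rewrite cnorm10.
by rewrite (le_trans (cnorm1D _ _))// lerD.
Qed.
Lemma Re_le_cnorm1 z : `|complex.Re z| <= cnorm1 z.
Proof. by rewrite lerDl. Qed.
Lemma Im_le_cnorm1 z : `|complex.Im z| <= cnorm1 z.
Proof. by rewrite lerDr. Qed.
End complex1norm.

Section matrixnorms.
Variable R : realType.

Definition mxnorm1 m n (A : 'M[R[i]]_(m, n)) : R := \sum_i \sum_j cnorm1 (A i j).

Lemma mxnorm1_ge0 m n (A : 'M[R[i]]_(m, n)) : 0 <= mxnorm1 A.
Proof. by apply: sumr_ge0 => i _; apply: sumr_ge0 => j _; exact: cnorm1_ge0. Qed.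

Lemma entry_le_mxnorm1 m n (A : 'M[R[i]]_(m, n)) i j : cnorm1 (A i j) <= mxnorm1 A.
Proof.
rewrite /mxnorm1 (bigD1 i)//= (bigD1 j)//= -addrA lerDl addr_ge0//.
  by apply: sumr_ge0 => ? _; exact: cnorm1_ge0.
by apply: sumr_ge0 => ? _; apply: sumr_ge0 => ? _; exact: cnorm1_ge0.
Qed.

Lemma mxnorm1_le m n (A : 'M[R[i]]_(m, n)) c : (forall i j, cnorm1 (A i j) <= c) ->
  mxnorm1 A <= m%:R * n%:R * c.
Proof.
move=> Ac; rewrite /mxnorm1.
apply: (@le_trans _ _ (\sum_(i < m) \sum_(j < n) c)).
  by apply: ler_sum => i _; apply: ler_sum => j _.
by rewrite sumr_const sumr_const !card_ord -mulrA !mulr_natl.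
Qed.

Lemma mxnorm1D m n (A B : 'M[R[i]]_(m, n)) : mxnorm1 (A + B) <= mxnorm1 A + mxnorm1 B.
Proof.
rewrite /mxnorm1 -big_split/=; apply: ler_sum => i _.
by rewrite -big_split/=; apply: ler_sum => j _; rewrite mxE cnorm1D.
Qed.

Lemma mxnorm1N m n (A : 'M[R[i]]_(m, n)) : mxnorm1 (- A) = mxnorm1 A.
Proof. by rewrite /mxnorm1; apply: eq_bigr => i _; apply: eq_bigr => j _;
  rewrite mxE cnorm1N. Qed.

Lemma mxnorm1M m n p (A : 'M[R[i]]_(m, n)) (B : 'M[R[i]]_(n, p)) :
  mxnorm1 (A *m B) <= mxnorm1 A * mxnorm1 B.
Proof.
rewrite {1 2}/mxnorm1 mulr_suml; apply: ler_sum => i _.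
rewrite mulr_suml.
apply: (@le_trans _ _ (\sum_(j < p) \sum_(k < n) cnorm1 (A i k) * cnorm1 (B k j))).
  apply: ler_sum => j _; rewrite mxE (le_trans (cnorm1_sum _ _ _))//.
  by apply: ler_sum => k _; exact: cnorm1M.
rewrite exchange_big/=; apply: ler_sum => k _.
rewrite -mulr_sumr ler_wpM2l ?cnorm1_ge0//.
rewrite /mxnorm1 [leRHS](bigD1 k)//= lerDl.
by apply: sumr_ge0 => ? _; apply: sumr_ge0 => ? _; exact: cnorm1_ge0.
Qed.

Lemma mxnorm1Z m n z (A : 'M[R[i]]_(m, n)) : mxnorm1 (z *: A) <= cnorm1 z * mxnorm1 A.
Proof.
rewrite /mxnorm1 mulr_sumr; apply: ler_sum => i _; rewrite mulr_sumr.
by apply: ler_sum => j _; rewrite mxE cnorm1M.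
Qed.

Lemma mxnorm1_commutator d (A B : 'M[R[i]]_d) :
  mxnorm1 (commutator A B) <= 2 * (mxnorm1 A * mxnorm1 B).
Proof.
rewrite /commutator (le_trans (mxnorm1D _ _))// mxnorm1N.
have := mxnorm1M A B; have := mxnorm1M B A; lra.
Qed.

Lemma frobnormE m n (A : 'M[R[i]]_(m, n)) : frobnorm A =
  Num.sqrt (\sum_i \sum_j ((complex.Re (A i j)) ^+ 2 + (complex.Im (A i j)) ^+ 2)).
Proof.
rewrite /frobnorm /mxtrace Re_sum; congr Num.sqrt; apply: eq_bigr => i _.
rewrite mxE Re_sum; apply: eq_bigr => j _; rewrite !mxE.
by case: (A i j) => a b /=; ring.
Qed.

Lemma frobnorm_ge0 m n (A : 'M[R[i]]_(m, n)) : 0 <= frobnorm A.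
Proof. exact: sqrtr_ge0. Qed.

Lemma frobnorm0 m n : frobnorm (0 : 'M[R[i]]_(m, n)) = 0.
Proof. by rewrite /frobnorm mul0mx mxtrace0 sqrtr0. Qed.

Let sq m n (A : 'M[R[i]]_(m, n)) (p : 'I_m * 'I_n * bool) : R :=
  if p.2 then complex.Re (A p.1.1 p.1.2) else complex.Im (A p.1.1 p.1.2).

Let frobnorm_sq m n (A : 'M[R[i]]_(m, n)) : frobnorm A = Num.sqrt (\sum_p sq A p ^+ 2).
Proof.
rewrite frobnormE pair_bigA/= -[in RHS](pair_bigA _ (fun x b => sq A (x, b) ^+ 2))/=.
by congr Num.sqrt; apply: eq_bigr => -[i j] _; rewrite big_bool.
Qed.

Lemma sqrt_sumsq_triangle (I : finType) (x y : I -> R) :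
  Num.sqrt (\sum_k (x k + y k) ^+ 2) <=
  Num.sqrt (\sum_k x k ^+ 2) + Num.sqrt (\sum_k y k ^+ 2).
Proof.
have sq0 (z : I -> R) : 0 <= \sum_k z k ^+ 2 by apply: sumr_ge0 => k _; exact: sqr_ge0.
set X := Num.sqrt (\sum_k x k ^+ 2); set Y := Num.sqrt (\sum_k y k ^+ 2).
have X0 : 0 <= X by exact: sqrtr_ge0.
have Y0 : 0 <= Y by exact: sqrtr_ge0.
have X2 : X ^+ 2 = \sum_k x k ^+ 2 by rewrite sqr_sqrtr.
have Y2 : Y ^+ 2 = \sum_k y k ^+ 2 by rewrite sqr_sqrtr.
rewrite -[leRHS]ger0_norm ?addr_ge0// -sqrtr_sqr ler_wsqrtr//.
have -> : \sum_k (x k + y k) ^+ 2 = X ^+ 2 + 2 * \sum_k x k * y k + Y ^+ 2.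
  rewrite X2 Y2 mulr_sumr -!big_split/=; apply: eq_bigr => k _; ring.
set s := \sum_k x k * y k.
suff : s <= X * Y by nra.
have : 0 <= \sum_k (x k * Y - y k * X) ^+ 2 by exact: sq0.
have -> : \sum_k (x k * Y - y k * X) ^+ 2 = 2 * (X * Y) * (X * Y - s).
  have -> : \sum_k (x k * Y - y k * X) ^+ 2 =
      (\sum_k x k ^+ 2) * Y ^+ 2 + (\sum_k y k ^+ 2) * X ^+ 2 - s * (2 * (X * Y)).
    by rewrite !mulr_suml -sumrN -!big_split/=; apply: eq_bigr => k _; ring.
  by rewrite -X2 -Y2; ring.
have [XY|XY] := ltP 0 (X * Y).
  by rewrite pmulr_rge0 ?subr_ge0// mulr_gt0.
have {XY}/eqP : X * Y == 0 by rewrite eq_le XY mulr_ge0.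
move=> XY _; rewrite XY; move/eqP: XY; rewrite mulf_eq0 => /orP[] /eqP e.
  rewrite /s big1// => k _.
  have : x k ^+ 2 <= 0.
    rewrite (_ : 0 = X ^+ 2); last by rewrite e expr0n.
    rewrite X2 (bigD1 k)//= lerDl.
    by apply: sumr_ge0 => ? _; exact: sqr_ge0.
  by rewrite le_eqVlt ltNge sqr_ge0 orbF sqrf_eq0 => /eqP ->; rewrite mul0r.
rewrite /s big1// => k _.
have : y k ^+ 2 <= 0.
  rewrite (_ : 0 = Y ^+ 2); last by rewrite e expr0n.
  rewrite Y2 (bigD1 k)//= lerDl.
  by apply: sumr_ge0 => ? _; exact: sqr_ge0.
by rewrite le_eqVlt ltNge sqr_ge0 orbF sqrf_eq0 => /eqP ->; rewrite mulr0.
Qed.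

Lemma frobnormD m n (A B : 'M[R[i]]_(m, n)) :
  frobnorm (A + B) <= frobnorm A + frobnorm B.
Proof.
rewrite !frobnorm_sq (le_trans _ (sqrt_sumsq_triangle _ _))// le_eqVlt; apply/orP; left.
apply/eqP; congr Num.sqrt; apply: eq_bigr => -[[i j] b] _.
by rewrite /sq/= mxE; case: b; rewrite ?ReD ?ImD.
Qed.

Lemma frobnormN m n (A : 'M[R[i]]_(m, n)) : frobnorm (- A) = frobnorm A.
Proof.
rewrite !frobnormE; congr Num.sqrt; apply: eq_bigr => i _; apply: eq_bigr => j _.
by rewrite mxE ReN ImN !sqrrN.
Qed.

Lemma frobnormB m n (A B : 'M[R[i]]_(m, n)) : frobnorm (A - B) = frobnorm (B - A).
Proof. by rewrite -frobnormN opprB. Qed.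

Lemma Re_le_frobnorm m n (A : 'M[R[i]]_(m, n)) i j : `|complex.Re (A i j)|
  <= frobnorm A.
Proof.
rewrite frobnorm_sq -sqrtr_sqr ler_wsqrtr// (bigD1 (i, j, true))//= lerDl.
by apply: sumr_ge0 => ? _; exact: sqr_ge0.
Qed.

Lemma Im_le_frobnorm m n (A : 'M[R[i]]_(m, n)) i j : `|complex.Im (A i j)|
  <= frobnorm A.
Proof.
rewrite frobnorm_sq -sqrtr_sqr ler_wsqrtr// (bigD1 (i, j, false))//= lerDl.
by apply: sumr_ge0 => ? _; exact: sqr_ge0.
Qed.

Lemma cnorm1_le_frobnorm m n (A : 'M[R[i]]_(m, n)) i j :
  cnorm1 (A i j) <= 2 * frobnorm A.
Proof.
rewrite /cnorm1; have := Re_le_frobnorm A i j; have := Im_le_frobnorm A i j; lra.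
Qed.

Lemma mxnorm1_le_frobnorm d (A : 'M[R[i]]_d) :
  mxnorm1 A <= d%:R ^+ 2 * 2 * frobnorm A.
Proof.
rewrite (le_trans (mxnorm1_le (cnorm1_le_frobnorm A)))//.
by rewrite expr2 -!mulrA.
Qed.

Lemma frobnorm_le_mxnorm1 m n (A : 'M[R[i]]_(m, n)) : frobnorm A <= mxnorm1 A.
Proof.
rewrite -[leRHS]ger0_norm ?mxnorm1_ge0// -sqrtr_sqr frobnormE ler_wsqrtr//.
rewrite expr2 {1}/mxnorm1 mulr_suml; apply: ler_sum => i _.
rewrite mulr_suml; apply: ler_sum => j _.
rewrite (@le_trans _ _ (cnorm1 (A i j) * cnorm1 (A i j)))//; last first.
  by rewrite ler_wpM2l ?cnorm1_ge0// entry_le_mxnorm1.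
rewrite /cnorm1 -(real_normK (num_real (complex.Re (A i j)))).
rewrite -(real_normK (num_real (complex.Im (A i j)))).
have := normr_ge0 (complex.Re (A i j)); have := normr_ge0 (complex.Im (A i j)); nra.
Qed.

(** The trace is cyclic and [L^t* *m L = 1]. *)
Lemma frobnorm_unitary d (L X : 'M[R[i]]_d) : L \is unitarymx ->
  frobnorm (L *m X *m L^t*) = frobnorm X.
Proof.
move=> UL; rewrite /frobnorm; congr (Num.sqrt (complex.Re _)).
rewrite !trmx_mul !map_mxM trmxCK !mulmxA mulmxKtV// -!mulmxA mxtrace_mulC.
by rewrite -!mulmxA (mulmx1C (unitarymxP UL)) mulmx1.
Qed.

(** Positivity of this expression for [z] equal to 1, -1, i and -i bounds an
    off-diagonal entry of [rho] by the two diagonal ones. *)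
Lemma psd_form d (rho : 'M[R[i]]_d) i j z : i != j ->
  let v := delta_mx i 0 + z *: delta_mx j 0 : 'cV_d in
  (v^t* *m rho *m v) 0 0 =
  rho i i + rho i j * z + Num.conj z * rho j i + Num.conj z * rho j j * z.
Proof.
move=> ij v.
have [ij1 ij2] : (i == j) = false /\ (j == i) = false
  by rewrite [j == i]eq_sym (negbTE ij).
have vE k : v k 0 = (k == i)%:R + z * (k == j)%:R.
  by rewrite /v !mxE !eqxx !andbT.
rewrite mxE.
have -> : \sum_k (v^t* *m rho) 0 k * v k 0 = (v^t* *m rho) 0 i + (v^t* *m rho) 0 j * z.
  rewrite (bigD1 i)//= (bigD1 j)/= ?ij2// big1 => [|k /andP[ki kj]].
    by rewrite !vE !eqxx ij1 ij2; rewrite ?(mulr1,mulr0,addr0,add0r).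
  by rewrite vE (negbTE ki) (negbTE kj) mulr0 addr0 mulr0.
have vtE k : v^t* 0 k = Num.conj (v k 0) by rewrite !mxE.
have E l : (v^t* *m rho) 0 l = rho i l + Num.conj z * rho j l.
  rewrite mxE (bigD1 i)//= (bigD1 j)/= ?ij2// big1 => [|k /andP[ki kj]].
    by rewrite !vtE !vE !eqxx ij1 ij2 mulr1 mulr0 addr0 add0r rmorph1; ring.
  by rewrite vtE vE (negbTE ki) (negbTE kj) mulr0 addr0 rmorph0 mul0r.
by rewrite !E; ring.
Qed.

Lemma density_diag_ge0 d (rho : 'M[R[i]]_d) i : density rho -> 0 <= complex.Re (rho i
  i).
Proof.
case=> psd _ _; have := psd (delta_mx i 0).
have -> : ((delta_mx i 0 : 'cV[R[i]]_d)^t* *m rho *m (delta_mx i 0 : 'cV[R[i]]_d)) 0 0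
  = rho i i.
  rewrite -colE mxE mxE (bigD1 i)//= big1 => [|k /negbTE ki].
    by rewrite !mxE !eqxx rmorph1 mul1r addr0.
  by rewrite !mxE ki rmorph0 mul0r.
by rewrite lecE/= => /andP[].
Qed.

Lemma density_entries d (rho : 'M[R[i]]_d) i j : density rho ->
  `|complex.Re (rho i j)| <= 1 /\ `|complex.Im (rho i j)| <= 1.
Proof.
move=> drho; have [psd tr1 herm] := drho.
have hermE k l : rho k l = Num.conj (rho l k) by rewrite {1}herm !mxE.
have diag k : complex.Re (rho k k) <= 1.
  have := congr1 (@complex.Re R) tr1; rewrite /mxtrace Re_sum /= => <-.
  rewrite (bigD1 k)//= lerDl; apply: sumr_ge0 => l _; exact: density_diag_ge0.
have diagI k : complex.Im (rho k k) = 0.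
  have := congr1 (@complex.Im R) (hermE k k); rewrite ImC => h; lra.
have [<-|ij] := eqVneq i j.
  by rewrite diagI normr0 ler01 ger0_norm ?density_diag_ge0.
have key z := psd (delta_mx i 0 + z *: delta_mx j 0).
have form z : 0 <= complex.Re (rho i i + rho i j * z + Num.conj z * rho j i
    + Num.conj z * rho j j * z).
  by rewrite -psd_form//; have := key z; rewrite lecE/= => /andP[].
have di := diag i; have dj := diag j; have dii := diagI i; have djj := diagI j.
have := form (Complex 1 0); have := form (Complex (-1) 0).
have := form (Complex 0 1); have := form (Complex 0 (-1)).
rewrite (hermE j i) !(ReD, ReM, ImM, ImD, ReC, ImC)/= !djj => h1 h2 h3 h4.
by split; rewrite ler_norml; apply/andP; split; lra.
Qed.

Lemma density_mxnorm1 d (rho : 'M[R[i]]_d) : density rho ->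
  mxnorm1 rho <= 2 * d%:R ^+ 2.
Proof.
move=> drho; rewrite mulrC expr2; apply: mxnorm1_le => i j.
by have [] := density_entries i j drho; rewrite /cnorm1; lra.
Qed.

End matrixnorms.

(** * Bounded measurable functions and their integrals *)

Section bounded_measurable.
Context d (X : measurableType d) (R : realType).
Implicit Types (D : set X) (f g : X -> R).

(** All integrands below are bounded and live on sets of finite measure; this
    class is closed under the operations needed and implies integrability. *)
Definition bmeas D f := measurable_fun D f /\ exists c, forall x, D x -> `|f x| <= c.

Lemma bmeas_cst D c : bmeas D (fun=> c).
Proof. by split; [exact: measurable_cst | exists `|c|]. Qed.

Lemma bmeasD D f g : bmeas D f -> bmeas D g -> bmeas D (fun x => f x + g x).
Proof.
move=> [mf [a fa]] [mg [b gb]]; split; first exact: measurable_funD.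
by exists (a + b) => x Dx; rewrite (le_trans (ler_normD _ _))// lerD ?fa ?gb.
Qed.

Lemma bmeasN D f : bmeas D f -> bmeas D (fun x => - f x).
Proof.
move=> [mf [a fa]]; split; first exact: measurable_funN.
by exists a => x Dx; rewrite normrN fa.
Qed.

Lemma bmeasB D f g : bmeas D f -> bmeas D g -> bmeas D (fun x => f x - g x).
Proof. by move=> bf bg; apply: bmeasD => //; exact: bmeasN. Qed.

Lemma bmeasM D f g : bmeas D f -> bmeas D g -> bmeas D (fun x => f x * g x).
Proof.
move=> [mf [a fa]] [mg [b gb]]; split; first exact: measurable_funM.
by exists (a * b) => x Dx; rewrite normrM ler_pM ?fa ?gb.
Qed.

Lemma bmeas_norm D f : bmeas D f -> bmeas D (fun x => `|f x|).
Proof.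
move=> [mf [a fa]]; split; first exact: measurableT_comp.
by exists a => x Dx; rewrite normr_id fa.
Qed.

Lemma bmeas_sum D (I : Type) (r : seq I) (F : I -> X -> R) :
  (forall k, bmeas D (F k)) -> bmeas D (fun x => \sum_(k <- r) F k x).
Proof.
move=> bF; elim: r => [|k r ih].
  by under [X in bmeas _ X]eq_fun do rewrite big_nil; exact: bmeas_cst.
by under [X in bmeas _ X]eq_fun do rewrite big_cons; exact: bmeasD.
Qed.

Lemma bmeasS D E f : measurable E -> D `<=` E -> bmeas E f -> bmeas D f.
Proof.
move=> mE DE [mf [a fa]]; split; first exact: measurable_funS mf.
by exists a => x Dx; apply: fa; exact: DE.
Qed.

Lemma eq_bmeas D f g : (forall x, D x -> f x = g x) -> bmeas D f -> bmeas D g.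
Proof.
move=> fg [mf [a fa]]; split.
  by apply: eq_measurable_fun mf => x /set_mem Dx; exact: fg.
by exists a => x Dx; rewrite -fg// fa.
Qed.

Variables (mu : {measure set X -> \bar R}) (D : set X).
Hypotheses (mD : measurable D) (finD : (mu D < +oo)%E).

Lemma bmeas_integrable f : bmeas D f -> mu.-integrable D (EFin \o f).
Proof.
move=> [mf [a fa]]; apply: measurable_bounded_integrable => //.
exists a; split; first exact: num_real.
by move=> M aM x Dx /=; rewrite (le_trans (fa _ Dx))// ltW.
Qed.

Lemma Rintegral_sum (I : Type) (r : seq I) (F : I -> X -> R) :
  (forall k, bmeas D (F k)) ->
  \int[mu]_(x in D) (\sum_(k <- r) F k x) = \sum_(k <- r) \int[mu]_(x in D) F k x.
Proof.
move=> bF; elim: r => [|k r ih].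
  under eq_Rintegral do rewrite big_nil.
  by rewrite big_nil Rintegral_cst// mul0r.
under eq_Rintegral do rewrite big_cons.
rewrite big_cons RintegralD ?ih//; apply: bmeas_integrable => //.
exact: bmeas_sum.
Qed.

Lemma Rintegral_bound f c : bmeas D f -> (forall x, D x -> `|f x| <= c) ->
  `|\int[mu]_(x in D) f x| <= c * fine (mu D).
Proof.
move=> bf fc; rewrite (le_trans (le_normr_Rintegral _ _))//;
  first exact: bmeas_integrable.
rewrite -Rintegral_cst//; apply: le_Rintegral => //; apply: bmeas_integrable.
  exact: bmeas_norm.
exact: bmeas_cst.
Qed.

End bounded_measurable.

Section mx_bounded_measurable.
Context disp (X : measurableType disp) (R : realType).
Implicit Types (D : set X) (f g : X -> R[i]).

Definition cbmeas D f := bmeas D (fun x => complex.Re (f x)) /\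
                         bmeas D (fun x => complex.Im (f x)).

Lemma cbmeas_cst D c : cbmeas D (fun=> c).
Proof. by split; exact: bmeas_cst. Qed.

Lemma cbmeasD D f g : cbmeas D f -> cbmeas D g -> cbmeas D (fun x => f x + g x).
Proof.
move=> [rf cf] [rg cg]; split.
  by under [X in bmeas _ X]eq_fun do rewrite ReD; exact: bmeasD.
by under [X in bmeas _ X]eq_fun do rewrite ImD; exact: bmeasD.
Qed.

Lemma cbmeasN D f : cbmeas D f -> cbmeas D (fun x => - f x).
Proof.
move=> [rf cf]; split.
  by under [X in bmeas _ X]eq_fun do rewrite ReN; exact: bmeasN.
by under [X in bmeas _ X]eq_fun do rewrite ImN; exact: bmeasN.
Qed.

Lemma cbmeasC D f : cbmeas D f -> cbmeas D (fun x => Num.conj (f x)).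
Proof.
move=> [rf cf]; split.
  by under [X in bmeas _ X]eq_fun do rewrite ReC.
by under [X in bmeas _ X]eq_fun do rewrite ImC; exact: bmeasN.
Qed.

Lemma cbmeasM D f g : cbmeas D f -> cbmeas D g -> cbmeas D (fun x => f x * g x).
Proof.
move=> [rf cf] [rg cg]; split.
  by under [X in bmeas _ X]eq_fun do rewrite ReM; apply: bmeasB; exact: bmeasM.
by under [X in bmeas _ X]eq_fun do rewrite ImM; apply: bmeasD; exact: bmeasM.
Qed.

Lemma cbmeas_sum D (I : Type) (r : seq I) (F : I -> X -> R[i]) :
  (forall k, cbmeas D (F k)) -> cbmeas D (fun x => \sum_(k <- r) F k x).
Proof.
move=> bF; split.
  under [X in bmeas _ X]eq_fun do rewrite Re_sum.
  by apply: bmeas_sum => k; exact: (bF k).1.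
under [X in bmeas _ X]eq_fun do rewrite Im_sum.
by apply: bmeas_sum => k; exact: (bF k).2.
Qed.

Lemma cbmeas_cnorm1 D f : cbmeas D f -> bmeas D (fun x => cnorm1 (f x)).
Proof. by move=> [rf cf]; apply: bmeasD; exact: bmeas_norm. Qed.

Lemma cbmeasS D E f : measurable E -> D `<=` E -> cbmeas E f -> cbmeas D f.
Proof. by move=> mE DE [rf cf]; split; exact: (@bmeasS _ _ _ _ E). Qed.

Definition mbmeas m n D (f : X -> 'M[R[i]]_(m, n)) :=
  forall i j, cbmeas D (fun x => f x i j).

Lemma mbmeas_cst m n D (c : 'M[R[i]]_(m, n)) : mbmeas D (fun=> c).
Proof. by move=> i j; exact: cbmeas_cst. Qed.

Lemma mbmeasD m n D (f g : X -> 'M[R[i]]_(m, n)) : mbmeas D f -> mbmeas D g ->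
  mbmeas D (fun x => f x + g x).
Proof.
move=> bf bg i j; under [X in cbmeas _ X]eq_fun do rewrite mxE.
exact: cbmeasD.
Qed.

Lemma mbmeasN m n D (f : X -> 'M[R[i]]_(m, n)) : mbmeas D f ->
  mbmeas D (fun x => - f x).
Proof.
move=> bf i j; under [X in cbmeas _ X]eq_fun do rewrite mxE.
exact: cbmeasN.
Qed.

Lemma mbmeasB m n D (f g : X -> 'M[R[i]]_(m, n)) : mbmeas D f -> mbmeas D g ->
  mbmeas D (fun x => f x - g x).
Proof. by move=> bf bg; apply: mbmeasD => //; exact: mbmeasN. Qed.

Lemma mbmeasM m n p D (f : X -> 'M[R[i]]_(m, n)) (g : X -> 'M[R[i]]_(n, p)) :
  mbmeas D f -> mbmeas D g -> mbmeas D (fun x => f x *m g x).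
Proof.
move=> bf bg i j; under [X in cbmeas _ X]eq_fun do rewrite mxE.
by apply: cbmeas_sum => k; exact: cbmeasM.
Qed.

Lemma mbmeasZ m n D (z : X -> R[i]) (f : X -> 'M[R[i]]_(m, n)) :
  cbmeas D z -> mbmeas D f -> mbmeas D (fun x => z x *: f x).
Proof.
move=> bz bf i j; under [X in cbmeas _ X]eq_fun do rewrite mxE.
exact: cbmeasM.
Qed.

Lemma mbmeas_commutator n D (f g : X -> 'M[R[i]]_n) : mbmeas D f -> mbmeas D g ->
  mbmeas D (fun x => commutator (f x) (g x)).
Proof. by move=> bf bg; apply: mbmeasB; exact: mbmeasM. Qed.

Lemma mbmeas_mean_field n D a (f : X -> 'M[R[i]]_n) : mbmeas D f ->
  mbmeas D (fun x => mean_field a (f x)).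
Proof.
move=> bf i j; under [X in cbmeas _ X]eq_fun do rewrite mxE.
apply: cbmeas_sum => k; apply: cbmeas_sum => l; apply: cbmeasM.
  exact: cbmeas_cst.
exact: cbmeasC.
Qed.

Lemma mbmeas_mxnorm1 m n D (f : X -> 'M[R[i]]_(m, n)) : mbmeas D f ->
  bmeas D (fun x => mxnorm1 (f x)).
Proof.
by move=> bf; apply: bmeas_sum => i; apply: bmeas_sum => j; exact: cbmeas_cnorm1.
Qed.

Lemma mbmeasS m n D E (f : X -> 'M[R[i]]_(m, n)) :
  measurable E -> D `<=` E -> mbmeas E f -> mbmeas D f.
Proof. by move=> mE DE bf i j; exact: (@cbmeasS _ E). Qed.

Variables (mu : {measure set X -> \bar R}) (D : set X).
Hypotheses (mD : measurable D) (finD : (mu D < +oo)%E).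
Variable n : nat.
Implicit Types h k : X -> 'M[R[i]]_n.

Lemma mx_integralD h k : mbmeas D h -> mbmeas D k ->
  mx_integral mu D (fun x => h x + k x) = mx_integral mu D h + mx_integral mu D k.
Proof.
move=> bh bk; apply/matrixP => i j; rewrite !mxE/=.
have [h1 h2] := bh i j; have [k1 k2] := bk i j.
apply/eqP; rewrite eq_complex/= -!RintegralD//; try exact: bmeas_integrable.
by apply/andP; split; apply/eqP; apply: eq_Rintegral => x _; rewrite mxE ?ReD ?ImD.
Qed.

Lemma mx_integralN h : mbmeas D h ->
  mx_integral mu D (fun x => - h x) = - mx_integral mu D h.
Proof.
move=> bh; apply/matrixP => i j; rewrite !mxE/=.
have [h1 h2] := bh i j.
apply/eqP; rewrite eq_complex/=; apply/andP; split; apply/eqP.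
  rewrite -mulN1r -RintegralZl//; last exact: bmeas_integrable.
  by apply: eq_Rintegral => x _; rewrite mxE ReN mulN1r.
rewrite -mulN1r -RintegralZl//; last exact: bmeas_integrable.
by apply: eq_Rintegral => x _; rewrite mxE ImN mulN1r.
Qed.

Lemma mx_integralB h k : mbmeas D h -> mbmeas D k ->
  mx_integral mu D (fun x => h x - k x) = mx_integral mu D h - mx_integral mu D k.
Proof. by move=> bh bk; rewrite mx_integralD ?mx_integralN//; exact: mbmeasN. Qed.

Lemma eq_mx_integral h k : (forall x, D x -> h x = k x) ->
  mx_integral mu D h = mx_integral mu D k.
Proof.
move=> hk; apply/matrixP => i j; rewrite !mxE; congr Complex;
  by apply: eq_Rintegral => x /set_mem Dx; rewrite hk.
Qed.

Lemma mxnorm1_mx_integral h : mbmeas D h ->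
  mxnorm1 (mx_integral mu D h) <= \int[mu]_(x in D) mxnorm1 (h x).
Proof.
move=> bh; rewrite {2}/mxnorm1.
have bc i j : bmeas D (fun x => cnorm1 (h x i j)) by exact: cbmeas_cnorm1.
rewrite Rintegral_sum//; last by move=> i; exact: bmeas_sum.
apply: ler_sum => i _; rewrite Rintegral_sum//; apply: ler_sum => j _.
have [h1 h2] := bh i j.
rewrite /cnorm1 mxE/= RintegralD//; try exact/bmeas_integrable/bmeas_norm.
by rewrite lerD// le_normr_Rintegral//; exact: bmeas_integrable.
Qed.

End mx_bounded_measurable.

Section le_Rintegral_bmeas.
Context disp (X : measurableType disp) (R : realType).
Variables (mu : {measure set X -> \bar R}) (D : set X).
Hypotheses (mD : measurable D) (finD : (mu D < +oo)%E).

Lemma ler_Rint (f g : X -> R) : bmeas D f -> bmeas D g ->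
  (forall x, D x -> f x <= g x) ->
  \int[mu]_(x in D) f x <= \int[mu]_(x in D) g x.
Proof. by move=> bf bg fg; apply: le_Rintegral => //; exact: bmeas_integrable. Qed.

Lemma RintD (f g : X -> R) : bmeas D f -> bmeas D g ->
  \int[mu]_(x in D) (f x + g x) = \int[mu]_(x in D) f x + \int[mu]_(x in D) g x.
Proof. by move=> bf bg; apply: RintegralD => //; exact: bmeas_integrable. Qed.

Lemma RintZ (f : X -> R) c : bmeas D f ->
  \int[mu]_(x in D) (c * f x) = c * \int[mu]_(x in D) f x.
Proof. by move=> bf; apply: RintegralZl => //; exact: bmeas_integrable. Qed.

End le_Rintegral_bmeas.

(** * Integrals over time and Gronwall's inequality *)

Section time_integrals.
Variable R : realType.
Notation mu := (@lebesgue_measure R).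
Implicit Types (s t T : R) (f : R -> R).

Lemma itvcc_finite (a b : R) : (mu `[a, b]%classic < +oo)%E.
Proof. by rewrite lebesgue_measure_itv/=; case: ifPn => // _; rewrite -EFinB ltry. Qed.

Lemma lebesgue_itv (a b : R) (x y : bool) : a <= b ->
  mu [set` Interval (BSide x a) (BSide y b)] = (b - a)%:E.
Proof.
rewrite lebesgue_measure_itv/= lte_fin le_eqVlt => /predU1P[->|->].
  by rewrite ltxx subrr.
by rewrite -EFinB.
Qed.

Lemma RintcB T s t f : bmeas `[0, T]%classic f -> 0 <= s -> s <= t -> t <= T ->
  \int[mu]_(x in `[0, t]) f x - \int[mu]_(x in `[0, s]) f x =
  \int[mu]_(x in `]s, t]) f x.
Proof.
move=> bf s0 st tT; rewrite Rintegral_itvB ?bnd_simp//.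
apply: bmeas_integrable => //; first exact: itvcc_finite.
apply: bmeasS bf => // x/=; rewrite !in_itv/= => /andP[-> xt]/=.
exact: le_trans xt tT.
Qed.

Lemma subset_oc_cc T s t : 0 <= s -> t <= T -> `]s, t]%classic `<=` `[0, T]%classic.
Proof.
move=> s0 tT x/=; rewrite !in_itv/= => /andP[sx xt].
by rewrite (le_trans s0 (ltW sx)) (le_trans xt tT).
Qed.

Lemma subset_cc_cc T t : t <= T -> `[0, t]%classic `<=` `[0, T]%classic.
Proof.
move=> tT x/=; rewrite !in_itv/= => /andP[-> xt]/=; exact: le_trans xt tT.
Qed.

Lemma itvoc_finite (a b : R) : (mu `]a, b]%classic < +oo)%E.
Proof. by rewrite lebesgue_measure_itv/=; case: ifPn => // _; rewrite -EFinB ltry. Qed.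

Lemma Rintc_increment T s t f c : bmeas `[0, T]%classic f ->
  (forall x, `[0, T]%classic x -> `|f x| <= c) -> 0 <= s -> s <= t -> t <= T ->
  \int[mu]_(x in `[0, t]) f x - \int[mu]_(x in `[0, s]) f x <= c * (t - s).
Proof.
move=> bf fc s0 st tT; rewrite (RintcB bf)//.
rewrite (le_trans (ler_norm _))//.
have sub := subset_oc_cc s0 tT.
have <- : fine (mu `]s, t]%classic) = t - s by rewrite (lebesgue_itv false false st).
apply: Rintegral_bound => //.
- exact: itvoc_finite.
- exact: bmeasS bf.
- by move=> x /sub /fc.
Qed.

Lemma Rintc_mono T s t f : bmeas `[0, T]%classic f ->
  (forall x, `[0, T]%classic x -> 0 <= f x) -> 0 <= s -> s <= t -> t <= T ->
  \int[mu]_(x in `[0, s]) f x <= \int[mu]_(x in `[0, t]) f x.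
Proof.
move=> bf f0 s0 st tT; rewrite -subr_ge0 (RintcB bf)//.
apply: Rintegral_ge0 => x xst; apply: f0; exact: (subset_oc_cc s0 tT).
Qed.

Lemma mx_integralcB n T s t (f : R -> 'M[R[i]]_n) :
  mbmeas `[0, T]%classic f -> 0 <= s -> s <= t -> t <= T ->
  mx_integral mu `[0, t]%classic f - mx_integral mu `[0, s]%classic f =
  mx_integral mu `]s, t]%classic f.
Proof.
move=> bf s0 st tT; apply/matrixP => i j; rewrite !mxE.
have [f1 f2] := bf i j.
by rewrite -(RintcB f1 s0 st tT) -(RintcB f2 s0 st tT).
Qed.

Lemma Rint_expR (k t : R) : 0 < k -> 0 <= t ->
  \int[mu]_(s in `[0, t]) expR (k * s) = (expR (k * t) - 1) / k.
Proof.
move=> k0; rewrite le_eqVlt => /predU1P[<-|t0].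
  by rewrite set_itv1 Rintegral_set1 mulr0 expR0 subrr mul0r.
have dF (x : R) : is_derive x 1 (fun s => expR (k * s) / k) (expR (k * x)).
  have -> : (fun s : R => expR (k * s) / k) = (k^-1 \*: (expR \o (k \*: id))).
    by apply/funext => s; rewrite /GRing.scale/= mulrC.
  apply: is_derive_eq.
  by rewrite /GRing.scale/= mulr1 [_ * k]mulrC mulKf// gt_eqF.
have cF : continuous (fun s : R => expR (k * s) / k).
  by move=> x; apply: differentiable_continuous; apply/derivable1_diffP;
    have [] := dF x.
rewrite /Rintegral (@continuous_FTC2 _ _ (fun s => expR (k * s) / k))//.
- by rewrite mulr0 expR0 -EFinB/= -mulrBl.
- apply: continuous_subspaceT => x.
  apply: continuous_comp; last exact: continuous_expR.
  by apply: cvgM; [exact: cvg_cst|exact: cvg_id].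
- split; first by move=> x _; have [] := dF x.
  + exact/cvg_at_right_filter/cF.
  + exact/cvg_at_left_filter/cF.
- by move=> x _; rewrite derive1E; have [_ ->] := dF x.
Qed.

(** With [S] the supremum of [y t * expR (- 2 k t)], which is finite because [y]
    is bounded, integrating [y s <= S * expR (2 k s)] in the hypothesis gives
    [S <= h + S / 2]: the factor 2 in the exponent makes the integral term at
    most half of [S]. *)
Lemma gronwall (y : R -> R) T h k : 0 < T -> 0 < k ->
  bmeas `[0, T]%classic y -> (forall t, 0 <= t <= T -> 0 <= y t) ->
  (forall t, 0 <= t <= T -> y t <= h + k * \int[mu]_(s in `[0, t]) y s) ->
  forall t, 0 <= t <= T -> y t <= 2 * h * expR (2 * k * t).
Proof.
move=> T0 k0 by_ y0 yle.
have [_ [c yc]] := by_.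
pose S := sup [set y t * expR (- (2 * k * t)) | t in `[0, T]%classic].
have inS t : 0 <= t <= T -> y t * expR (- (2 * k * t)) <= S.
  move=> tT; apply: ub_le_sup; last by exists t.
  exists c => _ [s sT <-].
  rewrite (le_trans _ (yc _ sT))// ger0_norm ?y0//.
  rewrite -[leRHS]mulr1 ler_wpM2l ?y0//.
  move: sT; rewrite /= in_itv/= => /andP[s0 _].
  by rewrite -expR0 ler_expR oppr_le0 !mulr_ge0// ltW.
have yS t : 0 <= t <= T -> y t <= S * expR (2 * k * t).
  by move=> tT; rewrite -ler_pdivrMr ?expR_gt0// -expRN inS.
have h0 : 0 <= h.
  have := yle 0; rewrite lexx (ltW T0) => /(_ isT).
  rewrite set_itv1 Rintegral_set1 mulr0 addr0; apply: le_trans.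
  by rewrite y0// lexx ltW.
have S0 : 0 <= S.
  have := inS 0; rewrite lexx (ltW T0) => /(_ isT); apply: le_trans.
  by rewrite mulr_ge0 ?expR_ge0// y0// lexx ltW.
have be t : bmeas `[0, t]%classic (fun s => S * expR (2 * k * s)).
  split.
    apply: measurable_funM; first exact: measurable_cst.
    apply: measurableT_comp; first exact: measurable_expR.
    apply: measurable_funM; first exact: measurable_cst.
    exact: measurable_id.
  exists (S * expR (2 * k * t)) => x; rewrite /= in_itv/= => /andP[x0 xt].
  by rewrite ger0_norm ?mulr_ge0 ?expR_ge0// ler_wpM2l// ler_expR ler_wpM2l//
    mulr_ge0// ltW.
have half : S <= h + S / 2.
  apply: ge_sup; first by exists (y 0 * expR (- (2 * k * 0))); exists 0;
    rewrite //= in_itv/= lexx ltW.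
  move=> _ [t tT <-]; move: (tT); rewrite /= in_itv/= => /andP[t0 tleT].
  have E0 := expR_gt0 (2 * k * t).
  rewrite expRN ler_pdivrMr//.
  rewrite (le_trans (yle _ _)) ?t0//.
  have : \int[mu]_(s in `[0, t]) y s <= \int[mu]_(s in `[0, t]) (S * expR (2 * k * s)).
    apply: ler_Rint => //.
    - exact: itvcc_finite.
    - exact: (bmeasS _ (subset_cc_cc tleT)).
    - exact: be.
    - move=> x /(subset_cc_cc tleT); rewrite /= in_itv/=; exact: yS.
  rewrite RintegralZl//; last first.
    apply: bmeas_integrable => //; first exact: itvcc_finite.
    split.
      apply: measurableT_comp; first exact: measurable_expR.
      apply: measurable_funM; first exact: measurable_cst.
      exact: measurable_id.
    exists (expR (2 * k * t)) => x; rewrite /= in_itv/= => /andP[x0 xt].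
    by rewrite ger0_norm ?expR_ge0// ler_expR ler_wpM2l// mulr_ge0// ltW.
  rewrite Rint_expR ?mulr_gt0// => le1.
  have E1 : 1 <= expR (2 * k * t) by rewrite -expR0 ler_expR !mulr_ge0// ltW.
  have : k * (S * ((expR (2 * k * t) - 1) / (2 * k))) = S / 2 * (expR (2 * k * t) - 1).
    by field; rewrite gt_eqF.
  have := ler_wpM2l (ltW k0) le1.
  nra.
move=> t tT; apply: (le_trans (yS _ tT)); rewrite ler_wpM2r ?expR_ge0//.
lra.
Qed.

End time_integrals.

(** * Parametric integrals and Fubini *)

Section sections.
Context d1 d2 (X : measurableType d1) (Y : measurableType d2) (R : realType).
Variables (D1 : set X) (D2 : set Y).
Hypotheses (mD1 : measurable D1) (mD2 : measurable D2).
Implicit Types f : X * Y -> R.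

Lemma bmeas_restrict f : bmeas (D1 `*` D2) f ->
  measurable_fun setT (f \_ (D1 `*` D2)).
Proof.
move=> [mf _]; apply/(measurable_restrictT f) => //; exact: measurableX.
Qed.

Lemma bmeas_section1 f x : bmeas (D1 `*` D2) f -> D1 x ->
  bmeas D2 (fun y => f (x, y)).
Proof.
move=> bf D1x; have mf := bmeas_restrict bf; have [_ [c fc]] := bf.
split; last by exists c => y D2y; exact: fc.
apply: (@eq_measurable_fun _ _ _ _ _ (fun y => (f \_ (D1 `*` D2)) (x, y))).
  by move=> y /set_mem D2y; rewrite patchT//; apply/mem_set.
by apply: measurable_funTS; apply: measurableT_comp => //; exact: measurable_pair1.
Qed.

Lemma bmeas_section2 f y : bmeas (D1 `*` D2) f -> D2 y ->
  bmeas D1 (fun x => f (x, y)).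
Proof.
move=> bf D2y; have mf := bmeas_restrict bf; have [_ [c fc]] := bf.
split; last by exists c => x D1x; exact: fc.
apply: (@eq_measurable_fun _ _ _ _ _ (fun x => (f \_ (D1 `*` D2)) (x, y))).
  by move=> x /set_mem D1x; rewrite patchT//; apply/mem_set.
by apply: measurable_funTS; apply: measurableT_comp => //; exact: measurable_pair2.
Qed.

Variable m2 : {sigma_finite_measure set Y -> \bar R}.
Hypothesis fin2 : (m2 D2 < +oo)%E.

(** Adding the bound [c] of [f] makes the integrand nonnegative, so that the
    Tonelli form of measurability applies with no measure on the parameter
    space. *)
Lemma bmeas_param f : bmeas (D1 `*` D2) f ->
  bmeas D1 (fun x => \int[m2]_(y in D2) f (x, y)).
Proof.
move=> bf; have [_ [c fc]] := bf.
split; last first.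
  exists (c * fine (m2 D2)) => x D1x; apply: Rintegral_bound => //.
    exact: bmeas_section1.
  by move=> y D2y; exact: fc.
have bg : bmeas (D1 `*` D2) (fun p => f p + c) by apply: bmeasD => //; exact: bmeas_cst.
pose g := (fun p => f p + c) \_ (D1 `*` D2).
have mg : measurable_fun setT (EFin \o g) by apply/measurable_EFinP;
  exact: bmeas_restrict.
have g0 p : (0 <= (EFin \o g) p)%E.
  rewrite lee_fin /g patchE; case: ifPn => // /set_mem Dp.
  by have := fc _ Dp; rewrite ler_norml => /andP[? _]; lra.
have mG := @measurable_fun_fubini_tonelli_F _ _ _ _ _ m2 _ mg g0.
apply: (@eq_measurable_fun _ _ _ _ _
  (fun x => fine (\int[m2]_y (EFin \o g) (x, y))%E - c * fine (m2 D2))).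
  move=> x /set_mem D1x.
  have -> : fine (\int[m2]_y (EFin \o g) (x, y))%E = \int[m2]_(y in D2) (f (x, y) + c).
    rewrite Rintegral_mkcond /Rintegral; congr fine; apply: eq_integral => y _ /=.
    congr EFin; rewrite /g !patchE; congr (if _ then _ else _).
    by apply/idP/idP => [/set_mem[_ ?]|/set_mem ?]; apply/mem_set.
  rewrite RintD//; last exact: bmeas_cst.
    by rewrite Rintegral_cst// addrK.
  exact: bmeas_section1.
apply: measurable_funB; last exact: measurable_cst.
by apply: measurable_funTS; exact: measurableT_comp.
Qed.

End sections.

Section fubini_bmeas.
Context d1 d2 (X : measurableType d1) (Y : measurableType d2) (R : realType).
Variables (m1 : {sigma_finite_measure set X -> \bar R})
  (m2 : {sigma_finite_measure set Y -> \bar R}).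
Variables (D1 : set X) (D2 : set Y).
Hypotheses (mD1 : measurable D1) (mD2 : measurable D2).
Hypotheses (fin1 : (m1 D1 < +oo)%E) (fin2 : (m2 D2 < +oo)%E).
Variable f : X * Y -> R.
Hypothesis bf : bmeas (D1 `*` D2) f.

Let bparam2 : bmeas D2 (fun y => \int[m1]_(x in D1) f (x, y)).
Proof.
have bs : bmeas (D2 `*` D1) (fun p => f (p.2, p.1)).
  have [_ [c fc]] := bf; split; last by exists c => -[y x] [/= ? ?]; exact: fc.
  apply: (@eq_measurable_fun _ _ _ _ _ ((f \_ (D1 `*` D2)) \o unstable.swap)).
    by move=> [y x] /set_mem[/= D2y D1x]; rewrite /= patchT//; apply/mem_set.
  apply: measurable_funTS; apply: measurableT_comp; first exact: bmeas_restrict.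
  exact: measurable_swap.
exact: (@bmeas_param _ _ _ _ _ D2 D1 mD2 mD1 m1 fin1 _ bs).
Qed.

Let integrable_restr : (m1 \x m2)%E.-integrable setT (EFin \o (f \_ (D1 `*` D2))).
Proof.
rewrite -restrict_EFin; apply/integrable_restrict => //; first exact: measurableX.
rewrite setTI; apply: bmeas_integrable => //; first exact: measurableX.
rewrite /= [ltLHS]product_measure1E//.
by rewrite lte_mul_pinfty// ge0_fin_numE.
Qed.

Lemma prod_Rint : (\int[m1 \x m2]_(p in D1 `*` D2) (f p)%:E)%E =
  (\int[m1]_(x in D1) \int[m2]_(y in D2) f (x, y))%:E.
Proof.
rewrite integral_mkcond.
have -> : (\int[m1 \x m2]_p ((fun p => (f p)%:E) \_ (D1 `*` D2)) p =
           \int[m1 \x m2]_p (EFin \o (f \_ (D1 `*` D2))) p)%E.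
  by apply: eq_integral => p _; rewrite restrict_EFin.
rewrite -integral12_prod_meas1//.
rewrite /Rintegral fineK; last first.
  apply: integrable_fin_num => //; apply: bmeas_integrable => //.
  exact: bmeas_param.
rewrite [RHS]integral_mkcond; apply: eq_integral => x _.
rewrite /fubini_F patchE; case: ifPn => [/set_mem D1x|D1x].
  rewrite fineK; last first.
    apply: integrable_fin_num => //; apply: bmeas_integrable => //.
    exact: (bmeas_section1 mD1 mD2 bf D1x).
  rewrite [RHS]integral_mkcond; apply: eq_integral => y _.
  rewrite /= !patchE; have [D2y|D2y] := boolP (y \in D2).
    by rewrite ifT//; apply/mem_set; split => //; exact: set_mem.
  rewrite ifF//; apply/negbTE; apply: contra D2y => /set_mem[_ ?]; exact: mem_set.
apply: integral0_eq => y _; rewrite /= patchE ifF//.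
by apply/negbTE; apply: contra D1x => /set_mem[? _]; exact: mem_set.
Qed.

Lemma prod_Rint2 : (\int[m1 \x m2]_(p in D1 `*` D2) (f p)%:E)%E =
  (\int[m2]_(y in D2) \int[m1]_(x in D1) f (x, y))%:E.
Proof.
rewrite integral_mkcond.
have -> : (\int[m1 \x m2]_p ((fun p => (f p)%:E) \_ (D1 `*` D2)) p =
           \int[m1 \x m2]_p (EFin \o (f \_ (D1 `*` D2))) p)%E.
  by apply: eq_integral => p _; rewrite restrict_EFin.
rewrite -integral21_prod_meas1//.
rewrite /Rintegral fineK; last first.
  by apply: integrable_fin_num => //; apply: bmeas_integrable.
rewrite [RHS]integral_mkcond; apply: eq_integral => y _.
rewrite /fubini_G patchE; case: ifPn => [/set_mem D2y|D2y].
  rewrite fineK; last first.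
    apply: integrable_fin_num => //; apply: bmeas_integrable => //.
    exact: (bmeas_section2 mD1 mD2 bf D2y).
  rewrite [RHS]integral_mkcond; apply: eq_integral => x _.
  rewrite /= !patchE; have [D1x|D1x] := boolP (x \in D1).
    by rewrite ifT//; apply/mem_set; split => //; exact: set_mem.
  rewrite ifF//; apply/negbTE; apply: contra D1x => /set_mem[? _]; exact: mem_set.
apply: integral0_eq => x _; rewrite /= patchE ifF//.
by apply/negbTE; apply: contra D2y => /set_mem[_ ?]; exact: mem_set.
Qed.

Lemma Rint_swap : \int[m1]_(x in D1) \int[m2]_(y in D2) f (x, y) =
  \int[m2]_(y in D2) \int[m1]_(x in D1) f (x, y).
Proof. by apply: EFin_inj; rewrite -prod_Rint prod_Rint2. Qed.

End fubini_bmeas.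

(** * The cut norm *)

Section cut.
Variable R : realType.
Notation mu := (@lebesgue_measure R).
Notation I := (@unit_itv R).

Lemma measurable_unit_itv : measurable I. Proof. exact: measurable_itv. Qed.
Lemma lebesgue_unit_itv : mu I = 1%:E.
Proof. by rewrite /unit_itv lebesgue_measure_itv/= lte_fin ltr01 oppr0 adde0. Qed.
Lemma unit_itv_finite : (mu I < +oo)%E. Proof. by rewrite lebesgue_unit_itv ltry. Qed.
Lemma unit_itv_subset_finite (B : set R) : measurable B -> B `<=` I -> (mu B < +oo)%E.
Proof.
move=> mB BI; apply: le_lt_trans unit_itv_finite; apply: le_measure => //;
  apply/mem_set => //.
exact: measurable_unit_itv.
Qed.

(** Split [I] according to the sign of [g]. *)
Lemma Rint_abs_le (g : R -> R) k : bmeas I g ->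
  (forall B, measurable B -> B `<=` I -> `|\int[mu]_(x in B) g x| <= k) ->
  \int[mu]_(x in I) `|g x| <= 2 * k.
Proof.
move=> bg gk; have mg := bg.1.
pose P := I `&` g @^-1` `[0, +oo[%classic; pose Q := I `&` g @^-1` `]-oo, 0[%classic.
have mP : measurable P by apply: mg => //; exact: measurable_unit_itv.
have mQ : measurable Q by apply: mg => //; exact: measurable_unit_itv.
have PI : P `<=` I by move=> x [].
have QI : Q `<=` I by move=> x [].
have IE : I = P `|` Q.
  apply/seteqP; split=> [x Ix|x [/PI|/QI]//].
  by have [gx|gx] := leP 0 (g x); [left|right]; split => //=; rewrite in_itv/= ?andbT.
have bn : bmeas I (fun x => `|g x|) by exact: bmeas_norm.
have : \int[mu]_(x in I) `|g x| = \int[mu]_(x in P) `|g x| + \int[mu]_(x in Q) `|g x|.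
  rewrite {1}IE Rintegral_setU//.
    rewrite -IE; apply: bmeas_integrable => //; [exact: measurable_unit_itv|
      exact: unit_itv_finite].
  apply/disj_setPS => x [[_ /=]]; rewrite in_itv/= andbT => gx [_ /=].
  by rewrite in_itv/= ltNge gx.
have -> : \int[mu]_(x in P) `|g x| = \int[mu]_(x in P) g x.
  apply: eq_Rintegral => x /set_mem[_ /=]; rewrite in_itv/= andbT => gx.
  by rewrite ger0_norm.
have -> : \int[mu]_(x in Q) `|g x| = - \int[mu]_(x in Q) g x.
  rewrite -mulN1r -RintZ//; first last.
  - exact: (bmeasS measurable_unit_itv QI).
  - exact: unit_itv_subset_finite.
  apply: eq_Rintegral => x /set_mem[_ /=]; rewrite in_itv/= => gx.
  by rewrite mulN1r ltr0_norm.
move=> ->; have := gk _ mP PI; have := gk _ mQ QI.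
by rewrite !ler_norml => /andP[? ?] /andP[? ?]; lra.
Qed.

(** The measure is defined on a copy of [R] that is convertible to it but carries
    another name for the Borel structure; the statements with suffix [R] fix
    this copy once and for all. *)
Lemma bmeas_paramR d (X : measurableType d) (D : set X) (B : set R) (f : X * R -> R) :
  measurable D -> measurable B -> (mu B < +oo)%E -> bmeas (D `*` B) f ->
  bmeas D (fun x => \int[mu]_(y in B) f (x, y)).
Proof.
move=> mD mB finB bf.
exact: (@bmeas_param _ _ X (measurableTypeR R) R D B mD mB mu finB f bf).
Qed.

Lemma Rint_swapR (A B : set R) (f : R * R -> R) :
  measurable A -> measurable B -> (mu A < +oo)%E -> (mu B < +oo)%E ->
  bmeas (A `*` B) f ->
  \int[mu]_(x in A) \int[mu]_(y in B) f (x, y) =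
  \int[mu]_(y in B) \int[mu]_(x in A) f (x, y).
Proof.
move=> mA mB finA finB bf.
exact: (@Rint_swap _ _ (measurableTypeR R) (measurableTypeR R) R mu mu A B mA mB finA
  finB f bf).
Qed.

(** Bang-bang principle: the absolute value outside and the weight [f] inside are
    both removed by splitting [I] along the sign of the function that they
    multiply, each time at the cost of a factor 2. *)
Lemma cut_weight (K : R -> R -> R) (f : R -> R) (M k : R) :
  bmeas (I `*` I) (fun p => K p.1 p.2) -> bmeas I f -> 0 <= M ->
  (forall v, I v -> `|f v| <= M) ->
  (forall B1 B2, measurable B1 -> B1 `<=` I -> measurable B2 -> B2 `<=` I ->
    `|\int[mu]_(u in B1) \int[mu]_(v in B2) K u v| <= k) ->
  \int[mu]_(u in I) `|\int[mu]_(v in I) (K u v * f v)| <= 4 * M * k.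
Proof.
move=> bK bf M0 fM Kk.
have mII : measurable (I `*` I) by apply: measurableX; exact: measurable_unit_itv.
have measurable_unit_itv := measurable_unit_itv.
have unit_itv_finite := unit_itv_finite.
have bKf : bmeas (I `*` I) (fun p => K p.1 p.2 * f p.2).
  apply: bmeasM => //; have [mf [c fc]] := bf; split;
    last by exists c => -[u v] [_] /=; exact: fc.
  apply: (@eq_measurable_fun _ _ _ _ _ ((f \_ I) \o snd)).
    by move=> [u v] /set_mem[/= _ Iv]; rewrite /= patchT//; apply/mem_set.
  apply: measurable_funTS; apply: measurableT_comp; last exact: measurable_snd.
  exact/(measurable_restrictT f measurable_unit_itv).
rewrite (_ : 4 * M * k = 2 * (M * (2 * k))); last by ring.
apply: Rint_abs_le; first exact: (bmeas_paramR measurable_unit_itv measurable_unit_itv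
  unit_itv_finite bKf).
move=> B mB BI.
have finB := unit_itv_subset_finite mB BI.
have bKB : bmeas (B `*` I) (fun p => K p.1 p.2).
  by apply: bmeasS bK => // -[u v] [/= /BI].
have bKfB : bmeas (B `*` I) (fun p => K p.1 p.2 * f p.2).
  by apply: bmeasS bKf => // -[u v] [/= /BI].
have bKB' : bmeas (I `*` B) (fun p => K p.2 p.1).
  have [mK [c Kc]] := bKB; split; last by exists c => -[v u] [/= ? ?];
    exact: (Kc (u, v)).
  apply: (@eq_measurable_fun _ _ _ _ _ (((fun p => K p.1 p.2) \_ (B `*` I)) \o
    unstable.swap)).
    by move=> [v u] /set_mem[/= Iv Bu]; rewrite /= patchT//; apply/mem_set.
  apply: measurable_funTS; apply: measurableT_comp; last exact: measurable_swap.
  exact: bmeas_restrict.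
rewrite (Rint_swapR mB measurable_unit_itv finB unit_itv_finite bKfB).
pose h v := \int[mu]_(u in B) K u v.
have bh : bmeas I h by exact: (bmeas_paramR measurable_unit_itv mB finB bKB').
have -> : \int[mu]_(v in I) \int[mu]_(u in B) (K u v * f v) = \int[mu]_(v in I) (f v *
  h v).
  apply: eq_Rintegral => v /set_mem Iv; rewrite -RintZ//.
    by apply: eq_Rintegral => u _; rewrite mulrC.
  exact: (bmeas_section1 measurable_unit_itv mB bKB' Iv).
rewrite (le_trans (le_normr_Rintegral _ _))//.
  by apply: bmeas_integrable => //; exact: bmeasM.
apply: (@le_trans _ _ (\int[mu]_(v in I) (M * `|h v|))).
  apply: ler_Rint => //.
  - by apply: bmeas_norm; exact: bmeasM.
  - by apply: bmeasM; [exact: bmeas_cst|exact: bmeas_norm].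
  - by move=> v Iv; rewrite normrM ler_wpM2r// fM.
rewrite RintZ//; last exact: bmeas_norm.
rewrite ler_wpM2l//; apply: Rint_abs_le => // B2 mB2 B2I.
rewrite -(@Rint_swapR B B2 (fun p => K p.1 p.2) mB mB2 finB (unit_itv_subset_finite
  mB2 B2I)).
  exact: Kk.
by apply: bmeasS bK => // -[u v] [/= /BI ? /B2I ?].
Qed.

(** The cut norm of a bounded kernel is finite, and by Fubini it bounds the
    iterated integrals over rectangles. *)
Lemma cut_norm_spec (W : R -> R -> R) : bmeas (I `*` I) (fun p => W p.1 p.2) ->
  exists k : R, [/\ 0 <= k, cut_norm W = k%:E &
  forall B1 B2, measurable B1 -> B1 `<=` I -> measurable B2 -> B2 `<=` I ->
    `|\int[mu]_(u in B1) \int[mu]_(v in B2) W u v| <= k].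
Proof.
move=> bW; have [_ [c Wc]] := bW.
have mII : measurable (I `*` I) by apply: measurableX; exact: measurable_unit_itv.
have E B1 B2 : measurable B1 -> B1 `<=` I -> measurable B2 -> B2 `<=` I ->
    (`|\int[(mu \x mu)]_(p in B1 `*` B2) (W p.1 p.2)%:E| =
    `|\int[mu]_(u in B1) \int[mu]_(v in B2) W u v|%:E)%E.
  move=> mB1 B1I mB2 B2I.
  rewrite (@prod_Rint _ _ (measurableTypeR R) (measurableTypeR R) R mu mu B1 B2 mB1
    mB2 _ _ (fun p => W p.1 p.2))//.
  - exact: unit_itv_subset_finite.
  - exact: unit_itv_subset_finite.
  - by apply: bmeasS bW => // -[u v] [/= /B1I ? /B2I ?].
have ub : (cut_norm W <= (`|c|)%:E)%E.
  apply: ge_ereal_sup => _ [B1 [B2 [[mB1 B1I] [mB2 B2I] ->]]].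
  rewrite E// lee_fin.
  have bWB : bmeas (B1 `*` B2) (fun p => W p.1 p.2).
    by apply: bmeasS bW => // -[u v] [/= /B1I ? /B2I ?].
  have le1 B : measurable B -> B `<=` I -> fine (mu B) <= 1.
    move=> mB BI; rewrite -[leRHS]/(fine 1%:E) fine_le//.
    + by rewrite ge0_fin_numE//; exact: unit_itv_subset_finite.
    + by rewrite -lebesgue_unit_itv; apply: le_measure => //; apply/mem_set => //;
      exact: measurable_unit_itv.
  have c0 := normr_ge0 c.
  have step B g : measurable B -> B `<=` I -> bmeas B g ->
      (forall x, B x -> `|g x| <= `|c|) -> `|\int[mu]_(x in B) g x| <= `|c|.
    move=> mB BI bg gc.
    apply: (@le_trans _ _ (`|c| * fine (mu B))).
      by apply: Rintegral_bound => //; exact: unit_itv_subset_finite.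
    by rewrite -[leRHS]mulr1 ler_wpM2l// le1.
  apply: (step) => //.
    exact: (bmeas_paramR mB1 mB2 (unit_itv_subset_finite mB2 B2I) bWB).
  move=> u B1u; apply: (step) => //.
    exact: (bmeas_section1 mB1 mB2 bWB B1u).
  move=> v B2v; rewrite (le_trans _ (ler_norm c))//.
  exact: (Wc (u, v) (conj (B1I _ B1u) (B2I _ B2v))).
have lb B1 B2 : measurable B1 -> B1 `<=` I -> measurable B2 -> B2 `<=` I ->
    ((`|\int[mu]_(u in B1) \int[mu]_(v in B2) W u v|)%:E <= cut_norm W)%E.
  by move=> mB1 B1I mB2 B2I; rewrite -E//; apply: ereal_sup_ubound; exists B1, B2.
have cge0 : (0 <= cut_norm W)%E.
  by apply: le_trans (lb set0 set0 _ _ _ _) => //; rewrite lee_fin.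
have cfin : cut_norm W \is a fin_num by rewrite ge0_fin_numE// (le_lt_trans ub)// ltry.
exists (fine (cut_norm W)); split; first exact: fine_ge0.
  by rewrite fineK.
by move=> B1 B2 mB1 B1I mB2 B2I; rewrite -lee_fin fineK// lb.
Qed.

End cut.

(** * Integer-valued paths with one-sided limits *)

Section one_sided_neighborhoods.
Variable R : realType.
Implicit Types (t s e : R) (n : R -> nat).

Lemma near_rightP t (Q : R -> Prop) : (\forall s \near t^'+, Q s) <->
  exists2 e, 0 < e & forall s, t < s -> s < t + e -> Q s.
Proof.
split=> [|[e e0 Qe]].
  move=> /nbhs_ballP[e /= e0 eQ]; exists e => // s ts ste; apply: eQ => //=.
  by rewrite /ball/= distrC gtr0_norm ?subr_gt0// ltrBlDl.
apply/nbhs_ballP; exists e => //= s; rewrite /ball/= => tse ts.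
by apply: Qe => //; move: tse; rewrite distrC gtr0_norm ?subr_gt0// ltrBlDl.
Qed.

Lemma near_leftP t (Q : R -> Prop) : (\forall s \near t^'-, Q s) <->
  exists2 e, 0 < e & forall s, t - e < s -> s < t -> Q s.
Proof.
split=> [|[e e0 Qe]].
  move=> /nbhs_ballP[e /= e0 eQ]; exists e => // s ts ste; apply: eQ => //=.
  by rewrite /ball/= gtr0_norm ?subr_gt0// ltrBlDr -ltrBlDl.
apply/nbhs_ballP; exists e => //= s; rewrite /ball/= => tse ts.
by apply: Qe => //; move: tse; rewrite gtr0_norm ?subr_gt0// ltrBlDr -ltrBlDl.
Qed.

Lemma nat_near_eq (a b : nat) : `|a%:R - b%:R : R| < 1 -> a = b.
Proof.
move=> ab; apply/eqP; rewrite eqn_leq; move: ab; rewrite ltr_norml => /andP[h1 h2].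
apply/andP; split; rewrite -ltnS -(ltr_nat R) -natr1; lra.
Qed.

Definition jump_size n t : R := (n t)%:R - lim (((n r)%:R : R) @[r --> t^'-]).

Lemma right_locally_constant n t : ((n s)%:R : R) @[s --> t^'+] --> ((n t)%:R : R) ->
  exists2 e, 0 < e & forall s, t <= s -> s < t + e -> n s = n t.
Proof.
move=> /cvgrPdist_lt/(_ 1 ltr01)/near_rightP[e e0 H]; exists e => // s.
rewrite le_eqVlt => /predU1P[<-//|ts] ste.
by apply/esym/nat_near_eq; exact: H.
Qed.

Lemma left_locally_constant n t : cvg (((n s)%:R : R) @[s --> t^'-]) ->
  exists2 e, 0 < e & exists2 k : nat,
    forall s, t - e < s -> s < t -> n s = k &
    lim (((n r)%:R : R) @[r --> t^'-]) = k%:R.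
Proof.
move=> cn.
have h : 0 < 2^-1 :> R by [].
have /cvgrPdist_lt/(_ _ h)/near_leftP[e e0 H] := cn.
have He s : t - e < s -> s < t -> n s = n (t - e / 2).
  move=> s1 s2; apply: nat_near_eq.
  have h1 := H _ s1 s2.
  have h2 : `|lim (((n r)%:R : R) @[r --> t^'-]) - (n (t - e / 2))%:R| < 2^-1.
    by apply: H; lra.
  by move: h1 h2; rewrite !ltr_norml => /andP[? ?] /andP[? ?]; apply/andP; split; lra.
exists e => //; exists (n (t - e / 2)) => //.
apply/cvg_lim => //; apply: cvg_near_cst; apply/near_leftP; exists e => // s s1 s2.
by rewrite (He s).
Qed.

Lemma jump_size0 n t e : 0 < e -> (forall s, t - e < s -> s <= t -> n s = n t) ->
  jump_size n t = 0.
Proof.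
move=> e0 H; apply/eqP; rewrite subr_eq0; apply/eqP/esym/cvg_lim => //.
apply: cvg_near_cst; apply/near_leftP; exists e => // s s1 s2.
by rewrite (H s)// ltW.
Qed.

Lemma jump_size0_right n t : ((n s)%:R : R) @[s --> t^'+] --> ((n t)%:R : R) ->
  exists2 e, 0 < e & forall s, t < s -> s < t + e -> jump_size n s = 0.
Proof.
move=> /right_locally_constant[e e0 H]; exists e => // s ts ste.
apply: (@jump_size0 _ _ (s - t)); first by rewrite subr_gt0.
move=> r; rewrite subKr => tr rs.
by rewrite (H _ (ltW tr) (le_lt_trans rs ste)) (H _ (ltW ts) ste).
Qed.

Lemma jump_size0_left n t : cvg (((n s)%:R : R) @[s --> t^'-]) ->
  exists2 e, 0 < e & forall s, t - e < s -> s < t -> jump_size n s = 0.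
Proof.
move=> /left_locally_constant[e e0 [k H _]]; exists e => // s ts ste.
apply: (@jump_size0 _ _ (s - (t - e))); first by rewrite subr_gt0.
move=> r; rewrite subKr => tr rs.
by rewrite (H _ tr (le_lt_trans rs ste)) (H _ ts ste).
Qed.

(** Continuous analogue of induction on the natural numbers.  The supremum of
    the times up to which [Q] holds is reached by the third hypothesis and cannot
    be less than [T] by the second. *)
Lemma real_induction T (Q : R -> Prop) : Q 0 ->
  (forall t, 0 <= t -> t < T -> (forall s, 0 <= s <= t -> Q s) ->
     exists2 e, 0 < e & forall s, t < s -> s < t + e -> s <= T -> Q s) ->
  (forall t, 0 < t -> t <= T -> (forall s, 0 <= s -> s < t -> Q s) -> Q t) ->
  forall t, 0 <= t <= T -> Q t.
Proof.
move=> Q0 Qr Ql t tT.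
have T0 : 0 <= T by move: tT => /andP[? ?]; lra.
pose S := [set x | 0 <= x <= T /\ forall s, 0 <= s <= x -> Q s].
have S0 : S 0 by split => [|s s0]; rewrite ?lexx// (_ : s = 0)//; lra.
have supS : has_sup S by split; [exists 0|exists T => x [/andP[]]].
pose m := sup S.
have m0 : 0 <= m by apply: ub_le_sup => //; case: supS.
have mT : m <= T by apply: ge_sup; [exists 0|move=> x [/andP[]]].
have Qlt s : 0 <= s -> s < m -> Q s.
  move=> s0 sm; have [x [xT Qx] mx] : exists2 x, S x & s < x.
    by apply: sup_gt => //; exists 0.
  by apply: Qx; rewrite s0 ltW.
have Qm : Q m.
  move: m0; rewrite le_eqVlt => /predU1P[<-//|m0]; exact: Ql.
have Qle s : 0 <= s <= m -> Q s.
  by move=> /andP[s0]; rewrite le_eqVlt => /predU1P[->//|]; exact: Qlt.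
move: mT; rewrite le_eqVlt => /predU1P[mT|mT]; first by apply: Qle; rewrite mT.
have [e e0 He] := Qr _ m0 mT Qle.
pose x := m + Num.min (e / 2) (T - m).
have xS : S x.
  split.
    apply/andP; split; first by rewrite addr_ge0// le_min; apply/andP; split; lra.
    by rewrite -lerBrDl ge_min lexx orbT.
  move=> s /andP[s0 sx]; have [sm|ms] := leP s m; first by apply: Qle; rewrite s0.
  have xe : x < m + e by rewrite ltrD2l gt_min; apply/orP; left; lra.
  have xT : x <= T by rewrite -lerBrDl ge_min lexx orbT.
  by apply: He => //; lra.
have : x <= m by apply: ub_le_sup => //; case: supS.
by rewrite gerDl ge_min => /orP[]; lra.
Qed.

(** Half-open grid cells are closed on the right, so that the left end of the
    cell is strictly before [s]: it probes the left limit at [s]. *)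
Lemma grid_interval T s k : 0 < T -> 0 < s -> s <= T ->
  exists2 j : nat, (j < k.+1)%N &
    j%:R * (T / k.+1%:R) < s <= j.+1%:R * (T / k.+1%:R).
Proof.
move=> T0 s0 sT; set h := T / k.+1%:R.
have h0 : 0 < h by rewrite divr_gt0.
have ex : exists m, s <= m%:R * h.
  by exists k.+1; rewrite /h mulrC divfK// pnatr_eq0.
case: (ex_minnP ex) => [[|j]] sj mj; first by move: sj; rewrite mul0r leNgt s0.
exists j.
  by apply: mj; rewrite /h mulrC divfK// pnatr_eq0.
by rewrite sj andbT ltNge; apply/negP => /mj; rewrite ltnn.
Qed.

End one_sided_neighborhoods.

(** * Poisson processes have jumps of size one *)

Section simple_jumps.
Context (R : realType) (disp : measure_display) (Omega : measurableType disp)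
  (P : probability Omega R) (F : R -> set (set Omega)).

Lemma poisson_pmf_tail (h : R) : 0 < h ->
  1 - poisson_pmf h 0 - poisson_pmf h 1 <= h ^+ 2.
Proof.
move=> h0; rewrite /poisson_pmf h0 expr0 expr1 !invr1 !mul1r mulr1.
have := expR_ge1Dx (- h); nra.
Qed.

Lemma measurable_increment (N : R -> Omega -> nat) s t (D : set R) :
  usual_filtration P F -> poisson_process P F N -> 0 <= s -> 0 <= t ->
  measurable (increment N s t @^-1` D).
Proof.
move=> uF pN s0 t0.
have mN r k : 0 <= r -> measurable [set w | N r w = k].
  by move=> r0; apply: (filtration_sub uF r0); exact: (poisson_adapted pN).
have -> : increment N s t @^-1` D =
    \bigcup_i \bigcup_j
      (if ((j%:R - i%:R : R) \in D) then [set w | N s w = i] `&` [set w |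
        N t w = j] else set0).
  apply/seteqP; split => [w /= Dw|w [i _ [j _]]].
    exists (N s w) => //; exists (N t w) => //.
    by rewrite ifT//; apply/mem_set.
  by case: ifPn => // /set_mem Dij [/= si tj]; rewrite /increment si tj.
apply: bigcupT_measurable => i; apply: bigcupT_measurable => j.
by case: ifPn => // _; apply: measurableI; exact: mN.
Qed.

Lemma increment_tail (N : R -> Omega -> nat) s t :
  usual_filtration P F -> poisson_process P F N -> 0 <= s -> s < t ->
  (P (increment N s t @^-1` (~` [set 0%R; 1%R])) <= ((t - s) ^+ 2)%:E)%E.
Proof.
move=> uF pN s0 st; have t0 : 0 <= t by rewrite (le_trans s0)// ltW.
have mi D : measurable (increment N s t @^-1` D) by exact: measurable_increment.
have E0 : P (increment N s t @^-1` [set 0]) = (poisson_pmf (t - s) 0)%:E.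
  exact: (poisson_distr pN s0 st 0%N).
have E1 : P (increment N s t @^-1` [set 1]) = (poisson_pmf (t - s) 1)%:E.
  exact: (poisson_distr pN s0 st 1%N).
have E01 : P (increment N s t @^-1` [set 0; 1]) =
    (poisson_pmf (t - s) 0 + poisson_pmf (t - s) 1)%:E.
  rewrite preimage_setU measureU; [by rewrite EFinD; congr (_ + _)%E| | |].
  - exact: mi.
  - exact: mi.
  - by apply/seteqP; split=> // w [/= -> /esym/eqP]; rewrite oner_eq0.
rewrite -preimage_setC probability_setC ?E01//.
by rewrite -EFinB lee_fin opprD addrA poisson_pmf_tail// subr_gt0.
Qed.

(** A jump of [N] at [s] of size other than 0 or 1 shows up as the increment over
    the cell containing [s] of every sufficiently fine grid.  On the grid of
    mesh [T / n] the probability that some increment is neither 0 nor 1 is at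
    most [n * (T / n) ^+ 2], which tends to 0. *)
Theorem simple_jumps (N : R -> Omega -> nat) T :
  usual_filtration P F -> poisson_process P F N -> 0 < T ->
  {ae P, forall w, forall s, 0 < s <= T ->
     jump_size (N ^~ w) s = 0 \/ jump_size (N ^~ w) s = 1}.
Proof.
move=> uF pN T0.
pose g k (j : nat) : R := j%:R * (T / k.+1%:R).
have g0 k j : 0 <= g k j by rewrite mulr_ge0// divr_ge0// ltW.
have gS k j : g k j.+1 - g k j = T / k.+1%:R
  by rewrite /g -mulrBl -natrB// subSnn mul1r.
have gT k : g k k.+1 = T by rewrite /g mulrC divfK.
have glt k j : g k j < g k j.+1 by rewrite -subr_gt0 gS divr_gt0.
pose B k j := increment N (g k j) (g k j.+1) @^-1` (~` [set 0; 1]).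
have mB k j : measurable (B k j) by exact: measurable_increment.
pose E k := \big[setU/set0]_(j < k.+1) B k j.
have mE k : measurable (E k) by apply: bigsetU_measurable.
have PE k : (P (E k) <= (T ^+ 2 / k.+1%:R)%:E)%E.
  apply: (@le_trans _ _ (\sum_(j < k.+1) P (B k j))%E); first exact: Boole_inequality.
  apply: (@le_trans _ _ (\sum_(j < k.+1) ((T / k.+1%:R) ^+ 2)%:E)%E).
    by apply: lee_sum => j _; rewrite -(gS k j); exact: increment_tail.
  rewrite sumEFin lee_fin sumr_const card_ord -[X in X <= _]mulr_natl le_eqVlt;
    apply/orP; left.
  have : k.+1%:R != 0 :> R by rewrite pnatr_eq0.
  by move: (k.+1%:R : R) => c c0; apply/eqP; field.
have neg m : P.-negligible (\bigcap_(k in [set k | (m <= k)%N]) E k).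
  apply/negligibleP; first by apply: bigcap_measurable => //; exists m => /=.
  apply/eqP; rewrite eq_le measure_ge0 andbT.
  apply/lee_addgt0Pr => e e0; rewrite add0e.
  pose k := maxn m (Num.truncn (T ^+ 2 / e)).
  apply: (@le_trans _ _ (P (E k))).
    apply: le_measure; [apply/mem_set|exact/mem_set|].
      by apply: bigcap_measurable => //; exists m => /=.
    by apply: bigcap_inf; rewrite /= leq_maxl.
  apply: (le_trans (PE k)); rewrite lee_fin ler_pdivrMr// -ler_pdivrMl// mulrC.
  rewrite (le_trans (ltW (truncnS_gt _)))// ler_nat ltnS leq_maxr//.
apply: (@negligibleS _ _ _ _ (\bigcup_m \bigcap_(k in [set k | (m <= k)%N]) E k));
  last first.
  exact: negligible_bigcup.
move=> w /= /existsNP[s /not_implyP[/andP[s0 sT] /not_orP[j0 j1]]].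
have [e1 e10 H1] := right_locally_constant (@poisson_right _ _ _ _ _ _ pN w s (ltW s0)).
have [e2 e20 [l H2 El]] := left_locally_constant (@poisson_left _ _ _ _ _ _ pN w s s0).
pose e := Num.min e1 e2.
have e0 : 0 < e by rewrite lt_min e10.
exists (Num.truncn (T / e)) => // k /= mk.
have he : T / k.+1%:R < e.
  rewrite ltr_pdivrMr// -ltr_pdivrMl// mulrC.
  by rewrite (lt_le_trans (truncnS_gt _))// ler_nat ltnS.
have [j jk /andP[js sj]] := grid_interval k T0 s0 sT.
rewrite /E -bigcup_mkord; exists j => //.
rewrite /B/= /increment => inc.
have gj : g k j.+1 = g k j + T / k.+1%:R by rewrite -(gS k j) addrC subrK.
have [e1e e2e] : e <= e1 /\ e <= e2 by split; rewrite ge_min lexx ?orbT.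
have js' : g k j < s by [].
have sj' : s <= g k j + T / k.+1%:R by rewrite -gj.
have Nj1 : N (g k j.+1) w = N s w.
  by apply: H1; rewrite gj//; move: (T / _) js' sj' he => h js' sj' he; lra.
have Nj : N (g k j) w = l.
  by apply: H2 => //; move: (T / _) js' sj' he => h js' sj' he; lra.
by move: inc; rewrite Nj1 Nj -El => -[/j0|/j1].
Qed.

End simple_jumps.

(** * Left limits of matrix paths *)

Section left_limits.
Variables (R : realType) (d : nat) (T : R).
Implicit Types (f : R -> 'M[R[i]]_d) (t s e : R).

Lemma left_limP f t e : cadlag T f -> 0 < t -> t <= T -> 0 < e ->
  exists2 r, 0 < r &
    forall s, t - r < s -> s < t -> frobnorm (f s - left_lim f t) < e.
Proof.
move=> [_ cf] t0 tT e0; have t0T : 0 < t <= T by rewrite t0.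
rewrite /left_lim t0; have := xgetPex 0 (cf _ t0T).
move=> /cvgrPdist_lt/(_ _ e0)/near_leftP[r r0 H]; exists r => // s s1 s2.
by have := H _ s1 s2; rewrite sub0r normrN ger0_norm ?frobnorm_ge0.
Qed.

Lemma left_lim_mxnorm1 f t c : cadlag T f ->
  (forall s, 0 <= s <= T -> mxnorm1 (f s) <= c) -> 0 <= t <= T ->
  mxnorm1 (left_lim f t) <= c.
Proof.
move=> cf fc /andP[]; rewrite le_eqVlt => /predU1P[<- T0|t0 tT].
  by rewrite /left_lim ltxx; apply: fc; rewrite lexx.
apply/ler_addgt0Pr => e e0.
(* One is added so that [K] is positive also when [d] is 0. *)
pose K : R := d%:R ^+ 2 * 2 + 1.
have K0 : 0 < K by rewrite ltr_wpDl// mulr_ge0// exprn_ge0.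
have eK : 0 < e / K by rewrite divr_gt0.
have [r r0 H] := left_limP cf t0 tT eK.
pose s := Num.max 0 (t - r / 2).
have st : s < t by rewrite gt_max t0/=; lra.
have rs : t - r < s by rewrite lt_max; apply/orP; right; lra.
have s0 : 0 <= s by rewrite le_max lexx.
have := H _ rs st; rewrite frobnormB => h.
rewrite -[left_lim f t](subrK (f s)) addrC (le_trans (mxnorm1D _ _))//.
rewrite lerD//; first by apply: fc; rewrite s0 (le_trans (ltW st)).
rewrite (le_trans (mxnorm1_le_frobnorm _))//.
rewrite (@le_trans _ _ (K * frobnorm (left_lim f t - f s)))//.
  by rewrite ler_wpM2r ?frobnorm_ge0// /K lerDl.
by rewrite mulrC -ler_pdivlMr// ltW.
Qed.

Lemma left_lim_cvg_Re f t i j : cadlag T f -> 0 < t -> t <= T ->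
  complex.Re (f s i j) @[s --> t^'-] --> complex.Re (left_lim f t i j).
Proof.
move=> cf t0 tT; apply/cvgrPdist_lt => e e0; apply/near_leftP.
have [r r0 H] := left_limP cf t0 tT e0; exists r => // s s1 s2.
have := Re_le_frobnorm (left_lim f t - f s) i j.
rewrite !mxE ReD ReN frobnormB => /le_lt_trans; apply; exact: H.
Qed.

Lemma left_lim_cvg_Im f t i j : cadlag T f -> 0 < t -> t <= T ->
  complex.Im (f s i j) @[s --> t^'-] --> complex.Im (left_lim f t i j).
Proof.
move=> cf t0 tT; apply/cvgrPdist_lt => e e0; apply/near_leftP.
have [r r0 H] := left_limP cf t0 tT e0; exists r => // s s1 s2.
have := Im_le_frobnorm (left_lim f t - f s) i j.
rewrite !mxE ImD ImN frobnormB => /le_lt_trans; apply; exact: H.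
Qed.

(** The left limit at [s] is the limit of the values of [psi] at the left ends
    of the grid cells containing [s], that is of step functions. *)
Lemma left_limit_measurable (psi l : R -> R) : 0 < T ->
  (forall t, 0 < t -> t <= T -> psi s @[s --> t^'-] --> l t) ->
  measurable_fun `[0, T]%classic l.
Proof.
move=> T0 psil.
pose g k (j : nat) : R := j%:R * (T / k.+1%:R).
(* The last term only serves the point 0, which belongs to no grid cell. *)
pose h k (s : R) : R := (\sum_(j < k.+1) psi (g k j) * \1_(`]g k j,
  g k j.+1]%classic) s)
  + l 0 * \1_([set 0 : R]) s.
have gpos k : 0 < T / k.+1%:R by rewrite divr_gt0.
have hE k j s : (j < k.+1)%N -> g k j < s <= g k j.+1 -> h k s = psi (g k j).
  move=> jk /andP[js sj].
  rewrite /h (bigD1 (Ordinal jk))//= big1 => [|m mj].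
    rewrite indicE mem_set ?mulr1 ?addr0/= ?in_itv/= ?js// indicE memNset ?mulr0
      ?addr0//=.
    move=> s0; move: js; rewrite s0 ltNge => /negP; apply.
    by rewrite mulr_ge0// ltW.
  rewrite indicE memNset ?mulr0//= in_itv/= => /andP[ms sm].
  move/eqP: mj; apply; apply/val_inj/eqP => /=; rewrite eqn_leq.
  have := lt_le_trans ms sj; have := lt_le_trans js sm.
  by rewrite /g !ltr_pM2r// !ltr_nat !ltnS => -> ->.
apply: (@measurable_fun_cvg _ (measurableTypeR R) R _ h).
  move=> k; apply: measurable_funD.
    apply: measurable_sum => j; apply: measurable_funM; first exact: measurable_cst.
    by apply: measurable_funTS; exact: measurable_indic.
  apply: measurable_funM; first exact: measurable_cst.
  by apply: measurable_funTS; exact: measurable_indic.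
move=> s; rewrite /= in_itv/= => /andP[]; rewrite le_eqVlt => /predU1P[<- _|s0 sT].
  have -> : h ^~ 0 = fun=> l 0.
    apply/funext => k; rewrite /h big1 => [|j _].
      by rewrite add0r indicE mem_set// mulr1.
    rewrite indicE memNset ?mulr0//= in_itv/= => /andP[+ _].
    by rewrite ltNge mulr_ge0// ltW.
  exact: cvg_cst.
apply/cvgrPdist_lt => e e0.
have /cvgrPdist_lt/(_ _ e0)/near_leftP[r r0 H] := psil _ s0 sT.
exists (Num.truncn (T / r)) => // k /= mk.
have hr : T / k.+1%:R < r.
  rewrite ltr_pdivrMr// -ltr_pdivrMl// mulrC.
  by rewrite (lt_le_trans (truncnS_gt _))// ler_nat ltnS.
have [j jk js] := grid_interval k T0 s0 sT.
rewrite (hE k j)//; apply: H; last by case/andP: js.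
have gj : g k j.+1 = g k j + T / k.+1%:R by rewrite /g -natr1 mulrDl mul1r.
have /andP[js' sj'] : g k j < s <= g k j.+1 by [].
by move: sj'; rewrite gj; move: (T / _) hr => x; lra.
Qed.

Lemma left_lim_mbmeas f c : 0 < T -> cadlag T f ->
  (forall s, 0 <= s <= T -> mxnorm1 (f s) <= c) ->
  mbmeas `[0, T]%classic (left_lim f).
Proof.
move=> T0 cf fc i j; split; split.
- by apply: left_limit_measurable => // t t0 tT; exact: left_lim_cvg_Re.
- exists c => t; rewrite /= in_itv/= => tT.
  by rewrite (le_trans (Re_le_cnorm1 _))// (le_trans (entry_le_mxnorm1 _ _ _))//
    left_lim_mxnorm1.
- by apply: left_limit_measurable => // t t0 tT; exact: left_lim_cvg_Im.
- exists c => t; rewrite /= in_itv/= => tT.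
  by rewrite (le_trans (Im_le_cnorm1 _))// (le_trans (entry_le_mxnorm1 _ _ _))//
    left_lim_mxnorm1.
Qed.

(** Here the time is fixed and the limit is taken along a sequence increasing to
    it; the measurable variable is a parameter. *)
Lemma left_limit_measurable_param disp (Omega : measurableType disp)
    (psi : R -> Omega -> R) (l : Omega -> R) t : 0 < t ->
  (forall s, 0 <= s -> s < t -> measurable_fun setT (psi s)) ->
  (forall w, psi s w @[s --> t^'-] --> l w) ->
  measurable_fun setT l.
Proof.
move=> t0 mpsi psil.
pose u (n : nat) : R := t - t / n.+1%:R.
have un n : 0 <= u n /\ u n < t.
  split; last by rewrite ltrBlDr ltrDl divr_gt0.
  by rewrite subr_ge0 ler_pdivrMr// ler_peMr// ?ler1n// ltW.
apply: (@measurable_fun_cvg _ _ _ _ (fun n => psi (u n))).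
  by move=> n; have [? ?] := un n; exact: mpsi.
move=> w _; apply/cvgrPdist_lt => e e0.
have /cvgrPdist_lt/(_ _ e0)/near_leftP[r r0 H] := psil w.
exists (Num.truncn (t / r)) => // k /= mk.
have [_ ukt] := un k; apply: H => //.
rewrite /u ltrD2l ltrN2 ltr_pdivrMr// -ltr_pdivrMl// mulrC.
by rewrite (lt_le_trans (truncnS_gt _))// ler_nat ltnS.
Qed.

End left_limits.

(** * Jump sums and unitary jumps *)

Section jump_sums.
Variables (R : realType) (n : R -> nat) (T : R).
Hypothesis n_right : forall t, 0 <= t ->
  ((n s)%:R : R) @[s --> t^'+] --> ((n t)%:R : R).
Hypothesis n_left : forall t, 0 < t -> cvg (((n s)%:R : R) @[s --> t^'-]).

Let J t := `]0, t]%classic `&` [set r | jump_size n r <> 0].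

(** Jumps are isolated on either side of each time, hence they cannot accumulate
    in a compact interval.  Finiteness matters because a finitely supported sum
    is 0 by convention when the support is infinite. *)
Lemma finite_jumps t : 0 <= t <= T -> finite_set (J t).
Proof.
move: t; apply: (@real_induction R T (fun t => finite_set (J t))).
- apply: (sub_finite_set _ (finite_set0 R)) => r [/=]; rewrite in_itv/=.
  by move=> /andP[r0 rr]; have := lt_le_trans r0 rr; rewrite ltxx.
- move=> t t0 tT Jle; have [e e0 He] := jump_size0_right (n_right t0).
  exists e => // s ts ste sT.
  apply: (sub_finite_set _ (Jle t _)); last by rewrite t0 lexx.
  move=> r [/= /[!in_itv]/= /andP[r0 rs] Jr]; split => //=.
  rewrite in_itv/= r0 leNgt; apply/negP => tr; apply: Jr.
  by apply: He => //; exact: le_lt_trans rs ste.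
- move=> t t0 tT Jlt; have [e e0 He] := jump_size0_left (n_left t0).
  pose s := Num.max 0 (t - e / 2).
  have st : s < t by rewrite gt_max t0/=; lra.
  have es : t - e < s by rewrite lt_max; apply/orP; right; lra.
  have s0 : 0 <= s by rewrite le_max lexx.
  have fin : finite_set (J s `|` [set t]).
    by rewrite finite_setU; split; [exact: Jlt|exact: finite_set1].
  apply: (sub_finite_set _ fin) => r [/= /[!in_itv]/= /andP[r0 rt] Jr].
  move: rt; rewrite le_eqVlt => /predU1P[->|rt]; [by right|left].
  split => //=; rewrite in_itv/= r0 leNgt; apply/negP => sr; apply: Jr.
  by apply: He => //; exact: lt_trans es sr.
Qed.

Lemma jump_integral_step d (f : R -> 'M[R[i]]_d) s t :
  0 <= s -> s < t -> t <= T -> (forall r, s < r -> r < t -> jump_size n r = 0) ->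
  jump_integral n f t = jump_integral n f s + Complex (jump_size n t) 0 *: f t.
Proof.
move=> s0 st tT H; rewrite /jump_integral.
pose F r := Complex (jump_size n r) 0 *: f r.
have F0 r : jump_size n r = 0 -> F r = 0 by move=> j0; rewrite /F j0 scale0r.
have Js : \sum_(r \in J s) F r = \sum_(r \in `]0, s]%classic) F r.
  apply: fsbig_widen; first by move=> r [].
  by move=> r [rs nJ]; apply: F0; apply/not_notP => nz; apply: nJ.
have -> : \sum_(r \in `]0, t]%classic) F r = \sum_(r \in J s `|` [set t]) F r.
  apply/esym/fsbig_widen.
    move=> r [[]|->] /=; rewrite !in_itv/=.
      by move=> /andP[-> rs] _; rewrite (le_trans rs)// ltW.
    by rewrite lexx andbT (le_lt_trans s0).
  move=> r [/= /[!in_itv]/= /andP[r0 rt] nJ]; apply: F0; apply/not_notP => nz;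
    apply: nJ.
  move: rt; rewrite le_eqVlt => /predU1P[->|rt]; [by right|left].
  split => //=; rewrite in_itv/= r0 leNgt; apply/negP => sr; apply: nz.
  exact: H.
rewrite fsbigU0//=.
- by rewrite fsbig_set1 Js.
- by apply: finite_jumps; rewrite s0 (le_trans (ltW st)).
- by move=> r [[/= + _] rt]; rewrite rt in_itv/= => /andP[_]; rewrite leNgt st.
Qed.

(** [g] is a path with left limits [gl] and drift primitive [D], and [V] dominates
    the variation of [D].  Between jumps the norm of [g] grows by at most the
    variation of the drift; a jump turns [gl t] into [L *m gl t *m L^t*], which
    has the same norm, so the bound passes from the times before [t] to [t]. *)
Lemma unitary_jump_bound d (L : 'M[R[i]]_d) (g gl D : R -> 'M[R[i]]_d)
    (V : R -> R) (M : R) : L \is unitarymx -> 0 <= M ->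
  (forall s, 0 < s <= T -> jump_size n s = 0 \/ jump_size n s = 1) ->
  (forall t e, 0 < t -> t <= T -> 0 < e -> exists2 r, 0 < r &
    forall s, t - r < s -> s < t -> 0 <= s -> frobnorm (g s - gl t) < e) ->
  (forall s t, 0 <= s -> s < t -> t <= T ->
    (forall r, s < r -> r < t -> jump_size n r = 0) ->
    g t = g s + (D t - D s) + Complex (jump_size n t) 0 *: (L *m gl t *m L^t* - gl t))
      ->
  (forall s t, 0 <= s -> s <= t -> t <= T -> frobnorm (D t - D s) <= V t - V s) ->
  (forall s t, 0 <= s -> s <= t -> t <= T -> V t - V s <= M * (t - s)) ->
  g 0 = 0 -> V 0 = 0 ->
  forall t, 0 <= t <= T -> frobnorm (g t) <= V t.
Proof.
move=> UL M0 j01 glP gE DV VM g0 V0.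
apply: real_induction; first by rewrite g0 V0 frobnorm0.
- move=> t t0 tT Ht; have [e e0 He] := jump_size0_right (n_right t0).
  exists e => // s ts ste sT.
  rewrite (gE t s)//; last first.
    by move=> r tr rs; apply: He => //; exact: lt_trans ste.
  rewrite He// (_ : Complex 0 0 = 0)// scale0r addr0.
  rewrite (le_trans (frobnormD _ _))//.
  have gt : frobnorm (g t) <= V t by apply: Ht; rewrite t0 lexx.
  have Dts := DV t s t0 (ltW ts) sT.
  by rewrite (le_trans (lerD gt Dts))// addrC subrK.
- move=> t t0 tT Ht; apply/ler_addgt0Pr => e e0.
  have [r1 r10 H1] := jump_size0_left (n_left t0).
  have e4 : 0 < e / 4 by lra.
  have [r2 r20 H2] := glP _ _ t0 tT e4.
  have M1 : 0 < M + 1 by lra.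
  pose r := Num.min (Num.min r1 r2) (e / 4 / (M + 1)).
  have r0 : 0 < r by rewrite !lt_min r10 r20 divr_gt0.
  have rr1 : r <= r1 by rewrite !ge_min lexx.
  have rr2 : r <= r2 by rewrite !ge_min lexx orbT.
  have rM : M * r <= e / 4.
    have : r <= e / 4 / (M + 1) by rewrite !ge_min lexx orbT.
    rewrite ler_pdivlMr// => h; apply: le_trans h; rewrite mulrC ler_wpM2l//; lra.
  pose s := Num.max 0 (t - r / 2).
  have st : s < t by rewrite gt_max t0/=; lra.
  have rs : t - r < s by rewrite lt_max; apply/orP; right; lra.
  have s0 : 0 <= s by rewrite le_max lexx.
  have gs := H2 s (le_lt_trans (lerB (lexx t) rr2) rs) st s0.
  have Hs : frobnorm (g s) <= V s by exact: Ht.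
  have Ds := DV s t s0 (ltW st) tT.
  have Vs : V t - V s <= e / 4.
    apply: (le_trans (VM s t s0 (ltW st) tT)); apply: le_trans rM.
    by rewrite ler_wpM2l//; clear -r0 rs; lra.
  have V_mono : V s <= V t.
    by rewrite -subr_ge0 (le_trans (frobnorm_ge0 (D t - D s))).
  have gls : frobnorm (gl t) <= V s + e / 4.
    rewrite -[gl t](subrK (g s)) (le_trans (frobnormD _ _))//.
    by rewrite frobnormB addrC lerD// ltW.
  have j0 u : s < u -> u < t -> jump_size n u = 0.
    by move=> su ut; apply: H1 => //; apply: le_lt_trans su; apply: ltW;
      apply: le_lt_trans rs; rewrite lerB.
  have := gE s t s0 st tT j0.
  have [jt|jt] : jump_size n t = 0 \/ jump_size n t = 1 by apply: j01; rewrite t0.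
    rewrite jt (_ : Complex 0 0 = 0)// scale0r addr0 => ->.
    rewrite (le_trans (frobnormD _ _))//.
    by rewrite (le_trans (lerD Hs Ds))// addrC subrK lerDl ltW.
  rewrite jt (_ : Complex 1 0 = 1)// scale1r => ->.
  have -> : g s + (D t - D s) + (L *m gl t *m L^t* - gl t) =
      L *m gl t *m L^t* + (g s - gl t) + (D t - D s).
    by rewrite addrCA -[RHS]addrA; congr (_ + _); exact: addrAC.
  rewrite (le_trans (frobnormD _ _))//.
  have tri := frobnormD (L *m gl t *m L^t*) (g s - gl t).
  rewrite frobnorm_unitary// in tri.
  (* [gl t] is within [e / 4] of [g s], and its norm is that of its conjugate. *)
  have arith (p q b c x y z : R) : p <= q + b -> q <= y + z / 4 -> b < z / 4 ->
    c <= x - y -> 0 < z -> p + c <= x + z by clear; lra.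
  exact: arith tri gls gs Ds e0.
Qed.

End jump_sums.

(** * The mean-field interaction *)

Section mean_field_facts.
Variables (R : realType) (d : nat).
Implicit Types (a : 'I_d -> 'I_d -> 'I_d -> 'I_d -> R[i]) (X Y : 'M[R[i]]_d).

(** Bounds the ratio of the entrywise sum norm to the Frobenius norm: each of the
    [d ^ 2] entries contributes a real and an imaginary part. *)
Definition norm_ratio : R := d%:R ^+ 2 * 2.
Notation dimc := norm_ratio.

Lemma norm_ratio_ge0 : 0 <= dimc.
Proof. by rewrite mulr_ge0// exprn_ge0. Qed.

(** The values of the kernel are the entries of the matrix of the operator. *)
Lemma kernel_le_interaction_norm a x y x' y' :
  cnorm1 (a x y x' y') <= 2 * interaction_norm a.
Proof.
apply: le_trans (cnorm1_le_frobnorm (lin_mx (interaction_op a))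
  (mxvec_index x' y') (mxvec_index x y)).
suff -> : lin_mx (interaction_op a) (mxvec_index x' y') (mxvec_index x y) = a x y x'
  y' by [].
rewrite !mxE/= mxvecE mxE vec_mx_delta (bigD1 x')//= (bigD1 y')//= !big1.
- by rewrite mxE !eqxx mulr1 !addr0.
- move=> k kx; rewrite big1// => l _.
  by rewrite mxE (negbTE kx) mulr0.
- by move=> l ly; rewrite mxE (negbTE ly) andbF mulr0.
Qed.

Lemma mxnorm1_mean_field a X :
  mxnorm1 (mean_field a X) <= dimc * interaction_norm a * mxnorm1 X.
Proof.
have H i j : cnorm1 (mean_field a X i j) <= 2 * interaction_norm a * mxnorm1 X.
  rewrite mxE (le_trans (cnorm1_sum _ _ _))// /mxnorm1 mulr_sumr; apply: ler_sum => k _.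
  rewrite (le_trans (cnorm1_sum _ _ _))// mulr_sumr; apply: ler_sum => l _.
  rewrite (le_trans (cnorm1M _ _))// cnorm1C ler_wpM2r ?cnorm1_ge0//.
  exact: kernel_le_interaction_norm.
rewrite (le_trans (mxnorm1_le H))// le_eqVlt; apply/orP; left; apply/eqP.
by rewrite /dimc; ring.
Qed.

Lemma mean_fieldB a X Y : mean_field a (X - Y) = mean_field a X - mean_field a Y.
Proof.
apply/matrixP => i j; rewrite !mxE -sumrB; apply: eq_bigr => k _.
rewrite -sumrB; apply: eq_bigr => l _.
by rewrite !mxE rmorphB mulrBr.
Qed.

Lemma interaction_norm_ge0 a : 0 <= interaction_norm a.
Proof. exact: frobnorm_ge0. Qed.

(** Leibniz rule for differences. *)
Lemma commutatorB (X Y X' Y' : 'M[R[i]]_d) :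
  commutator X Y - commutator X' Y' = commutator X (Y - Y') + commutator (X - X') Y'.
Proof.
rewrite /commutator !mulmxBr !mulmxBl.
move: (X *m Y) (Y *m X) (X' *m Y') (Y' *m X') (X *m Y') (Y' *m X).
by move=> p q r s t w; apply/matrixP => i j; rewrite !mxE; ring.
Qed.

End mean_field_facts.

Section parametric_integrals.
Variable R : realType.
Notation mu := (@lebesgue_measure R).
Notation I := (@unit_itv R).

Lemma bmeas_snd d1 d2 (X : measurableType d1) (Y : measurableType d2)
    (D1 : set X) (D2 : set Y) (f : Y -> R) :
  measurable D2 -> bmeas D2 f -> bmeas (D1 `*` D2) (fun p => f p.2).
Proof.
move=> mD1 [mf [c fc]]; split; last by exists c => -[x y] [/= _ Dx]; exact: fc.
apply: (@eq_measurable_fun _ _ _ _ _ ((f \_ D2) \o snd)).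
  by move=> [x y] /set_mem[/= _ Dx]; rewrite /= patchT//; apply/mem_set.
apply: measurable_funTS; apply: measurableT_comp; last exact: measurable_snd.
exact/(measurable_restrictT f).
Qed.

Lemma bmeas_comp d1 d2 (X : measurableType d1) (Y : measurableType d2)
    (D : set X) (E : set Y) (phi : X -> Y) (f : Y -> R) :
  measurable E -> measurable_fun setT phi -> (forall x,
    D x -> E (phi x)) -> bmeas E f ->
  bmeas D (f \o phi).
Proof.
move=> mE mphi DE [mf [c fc]]; split; last by exists c => x Dx; apply: fc; exact: DE.
apply: (@eq_measurable_fun _ _ _ _ _ ((f \_ E) \o phi)).
  by move=> x /set_mem Dx; rewrite /= patchT//; apply/mem_set; exact: DE.
apply: measurable_funTS; apply: measurableT_comp => //.
exact/(measurable_restrictT f).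
Qed.

Lemma mbmeas_comp n d1 d2 (X : measurableType d1) (Y : measurableType d2)
    (D : set X) (E : set Y) (phi : X -> Y) (f : Y -> 'M[R[i]]_n) :
  measurable E -> measurable_fun setT phi -> (forall x,
    D x -> E (phi x)) -> mbmeas E f ->
  mbmeas D (f \o phi).
Proof.
move=> mE mphi DE bf i j; have [b1 b2] := bf i j; split.
  exact: (@bmeas_comp _ _ X Y D E phi (fun y => complex.Re (f y i j))).
exact: (@bmeas_comp _ _ X Y D E phi (fun y => complex.Im (f y i j))).
Qed.

Lemma mbmeas_param n dX (X : measurableType dX) (D : set X) (B : set R)
    (f : X * R -> 'M[R[i]]_n) :
  measurable D -> measurable B -> (mu B < +oo)%E -> mbmeas (D `*` B) f ->
  mbmeas D (fun x => mx_integral mu B (fun v => f (x, v))).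
Proof.
move=> mD mB finB bf i j; have [b1 b2] := bf i j; split.
  apply: (@eq_bmeas _ _ _ _ (fun x => \int[mu]_(v in B) complex.Re (f (x, v) i j))).
    by move=> x _; rewrite mxE.
  exact: (bmeas_paramR mD mB finB b1).
apply: (@eq_bmeas _ _ _ _ (fun x => \int[mu]_(v in B) complex.Im (f (x, v) i j))).
  by move=> x _; rewrite mxE.
exact: (bmeas_paramR mD mB finB b2).
Qed.

Lemma mbmeas_section n dX (X : measurableType dX) (D : set X) (B : set R)
    (f : X * R -> 'M[R[i]]_n) x :
  measurable D -> measurable B -> mbmeas (D `*` B) f -> D x ->
  mbmeas B (fun v => f (x, v)).
Proof.
move=> mD mB bf Dx i j; have [b1 b2] := bf i j; split.
  exact: (bmeas_section1 mD mB b1 Dx).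
exact: (bmeas_section1 mD mB b2 Dx).
Qed.

Lemma mx_integralBR n (D : set R) (h k : R -> 'M[R[i]]_n) :
  measurable D -> (mu D < +oo)%E -> mbmeas D h -> mbmeas D k ->
  mx_integral mu D (fun x => h x - k x) = mx_integral mu D h - mx_integral mu D k.
Proof.
move=> mD fD bh bk.
exact: (@mx_integralB _ (measurableTypeR R) R mu D mD fD n h k bh bk).
Qed.

Lemma mxnorm1_mx_integralR n (D : set R) (h : R -> 'M[R[i]]_n) :
  measurable D -> (mu D < +oo)%E -> mbmeas D h ->
  mxnorm1 (mx_integral mu D h) <= \int[mu]_(x in D) mxnorm1 (h x).
Proof.
move=> mD fD bh.
exact: (@mxnorm1_mx_integral _ (measurableTypeR R) R mu D mD fD n h bh).
Qed.

Lemma ler_RintR (D : set R) (f g : R -> R) :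
  measurable D -> (mu D < +oo)%E -> bmeas D f -> bmeas D g ->
  (forall x, D x -> f x <= g x) ->
  \int[mu]_(x in D) f x <= \int[mu]_(x in D) g x.
Proof.
move=> mD fD bf bg fg.
exact: (@ler_Rint _ (measurableTypeR R) R mu D mD fD f g bf bg fg).
Qed.

(** Used to turn an almost sure bound into a bound on an expectation. *)
Lemma Rint_ae_le disp (Omega : measurableType disp) (P : probability Omega R)
    (f : Omega -> R) (c : R) : bmeas setT f -> (forall w, 0 <= f w) ->
  {ae P, forall w, f w <= c} -> \int[P]_w f w <= c.
Proof.
move=> bf f0 fc.
have PT : P setT = 1%E by exact: probability_setT.
have probability_finite : (P setT < +oo)%E by rewrite PT ltry.
have fin := integrable_fin_num measurableT (bmeas_integrable measurableT
  probability_finite bf).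
have [w fw] : exists w, f w <= c.
  apply: contrapT => /forallNP nf; have [N [mN PN subN]] := fc.
  have : N = setT by apply/seteqP; split => // x _; apply: subN => /=; exact: nf.
  by move=> NT; move: PN; rewrite NT PT => /eqP; rewrite onee_eq0.
have c0 : 0 <= c by exact: le_trans (f0 w) fw.
rewrite -lee_fin fineK//.
apply: (@le_trans _ _ (\int[P]_w (cst c%:E) w)%E).
  apply: ae_ge0_le_integral => //.
  - by move=> x _; rewrite lee_fin.
  - by apply/measurable_EFinP; have [] := bf.
  - by apply: filterS fc => x ? _; rewrite lee_fin.
by rewrite integral_cst// [X in (_ * X)%E](PT : _ = 1%E) mule1.
Qed.

End parametric_integrals.

(** * A single solution *)

Section one_solution.
Variables (R : realType) (d : nat) (disp : measure_display)
  (Omega : measurableType disp) (P : probability Omega R)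
  (F : R -> set (set Omega)) (N : R -> R -> Omega -> nat) (T : R)
  (L H : 'M[R[i]]_d) (a : 'I_d -> 'I_d -> 'I_d -> 'I_d -> R[i])
  (rho0 : 'M[R[i]]_d) (W : R -> R -> R) (gamma : R -> R -> Omega -> 'M[R[i]]_d).
Hypotheses (T0 : 0 < T) (uF : usual_filtration P F).
Hypothesis gW : graphon W.
Hypothesis sol : solution P F N T L H a rho0 W gamma.
Notation mu := (@lebesgue_measure R).
Notation I := (@unit_itv R).
Notation TT := (`[0, T]%classic : set R).
Notation dimc := (@norm_ratio R d).
Notation m := (mean_left P gamma).
Notation A := (interaction_norm a).

Lemma measurable_horizon : measurable TT. Proof. exact: measurable_itv. Qed.
Lemma horizon_finite : (mu TT < +oo)%E. Proof. exact: itvcc_finite. Qed.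
Lemma measurable_horizonX : measurable (TT `*` I).
Proof.
by apply: measurableX; [exact: measurable_horizon| exact: measurable_unit_itv].
Qed.

Lemma solution_mxnorm1 u t w : I u -> 0 <= t <= T -> mxnorm1 (gamma u t w) <= dimc.
Proof.
move=> Iu tT; rewrite /dimc mulrC; apply: density_mxnorm1.
exact: (solution_density sol).
Qed.

Lemma left_mxnorm1 u t w : I u -> 0 <= t <= T ->
  mxnorm1 (left_lim (fun r => gamma u r w) t) <= dimc.
Proof.
move=> Iu tT; apply: (left_lim_mxnorm1 (solution_cadlag sol w Iu)) => // s sT.
exact: solution_mxnorm1.
Qed.

Lemma left_mbmeas_time u w : I u -> mbmeas TT (left_lim (fun r => gamma u r w)).
Proof.
move=> Iu; apply: (left_lim_mbmeas T0 (solution_cadlag sol w Iu)) => s sT.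
exact: solution_mxnorm1.
Qed.

Lemma solution_measurable u t i j : I u -> 0 <= t <= T ->
  measurable_fun setT (fun w => complex.Re (gamma u t w i j)) /\
  measurable_fun setT (fun w => complex.Im (gamma u t w i j)).
Proof.
move=> Iu tT; have t0 : 0 <= t by case/andP: tT.
split=> _ D mD; rewrite setTI; apply: (filtration_sub uF t0).
  exact: (solution_adapted sol Iu tT i j mD).1.
exact: (solution_adapted sol Iu tT i j mD).2.
Qed.

Lemma left_mbmeas_omega v t : I v -> 0 <= t <= T ->
  mbmeas setT (fun w => left_lim (fun r => gamma v r w) t).
Proof.
move=> Iv tT i j.
have bd w : cnorm1 (left_lim (fun r => gamma v r w) t i j) <= dimc.
  by rewrite (le_trans (entry_le_mxnorm1 _ _ _))// left_mxnorm1.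
have [mre mim] : measurable_fun setT (fun w => complex.Re (left_lim (fun r => gamma v
  r w) t i j)) /\
    measurable_fun setT (fun w => complex.Im (left_lim (fun r => gamma v r w) t i j)).
  move: (tT) => /andP[]; rewrite le_eqVlt => /predU1P[t0 _|t0 tleT].
    rewrite -t0 /left_lim ltxx; apply: solution_measurable => //.
    by rewrite lexx ltW.
  split.
    apply: (left_limit_measurable_param t0 (psi := fun s w => complex.Re (gamma v s w
      i j))).
      move=> s s0 st; apply: (solution_measurable i j Iv _).1.
      by rewrite s0 (le_trans (ltW st)).
    by move=> w; have := left_lim_cvg_Re (i := i) (j := j) (solution_cadlag sol w Iv)
      t0 tleT.
  apply: (left_limit_measurable_param t0 (psi := fun s w => complex.Im (gamma v s w i
    j))).
    move=> s s0 st; apply: (solution_measurable i j Iv _).2.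
    by rewrite s0 (le_trans (ltW st)).
  by move=> w; have := left_lim_cvg_Im (i := i) (j := j) (solution_cadlag sol w Iv) t0
    tleT.
split; split => //; exists dimc => w _.
  by rewrite (le_trans (Re_le_cnorm1 _)).
by rewrite (le_trans (Im_le_cnorm1 _)).
Qed.

Lemma probability_finite : (P setT < +oo)%E.
Proof. by rewrite [X in (X < _)%E](probability_setT P : _ = 1%E) ltry. Qed.

Lemma mean_mxnorm1 v t : I v -> 0 <= t <= T -> mxnorm1 (m t v) <= dimc.
Proof.
move=> Iv tT; have bl := left_mbmeas_omega Iv tT.
rewrite (le_trans (mxnorm1_mx_integral _ _ bl))//; first exact: probability_finite.
apply: Rint_ae_le; first exact: mbmeas_mxnorm1.
  by move=> w; exact: mxnorm1_ge0.
by apply: aeW => w; exact: left_mxnorm1.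
Qed.

Lemma mean_mbmeas : mbmeas (TT `*` I) (fun p => m p.1 p.2).
Proof.
move=> i j; have [mre mim] := solution_mean_measurable sol i j.
have bd t v : TT t -> I v -> cnorm1 (m t v i j) <= dimc.
  by move=> Tt Iv; rewrite (le_trans (entry_le_mxnorm1 _ _ _))// mean_mxnorm1.
split; split => //; exists dimc => -[t v] [/= Tt Iv].
  by rewrite (le_trans (Re_le_cnorm1 _))// bd.
by rewrite (le_trans (Im_le_cnorm1 _))// bd.
Qed.

Lemma graphon_bmeas : bmeas (I `*` I) (fun p => W p.1 p.2).
Proof.
split; first exact: (graphon_measurable gW).
exists 1 => -[u v] [/= Iu Iv].
by have /andP[W0 W1] := graphon_itv gW Iu Iv; rewrite ger0_norm.
Qed.

Lemma graphon_section u : I u -> bmeas I (W u).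
Proof.
move=> Iu.
have sec := bmeas_section1 (@measurable_unit_itv R) (@measurable_unit_itv R)
  graphon_bmeas Iu.
exact: sec.
Qed.

Lemma graphon_weight u v (X : 'M[R[i]]_d) : I u -> I v ->
  mxnorm1 (Complex (W u v) 0 *: X) <= mxnorm1 X.
Proof.
move=> Iu Iv; have /andP[W0 W1] := graphon_itv gW Iu Iv.
rewrite (le_trans (mxnorm1Z _ _))// /cnorm1/= normr0 addr0 ger0_norm//.
by rewrite ler_piMl// mxnorm1_ge0.
Qed.

Lemma field_mbmeas (w : R -> R) : bmeas I w ->
  mbmeas (TT `*` I) (fun p => Complex (w p.2) 0 *: mean_field a (m p.1 p.2)).
Proof.
move=> bw; apply: mbmeasZ; last by apply: mbmeas_mean_field; exact: mean_mbmeas.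
split; last exact: bmeas_cst.
by apply: (@bmeas_snd R _ _ R R TT I w) => //; exact: measurable_unit_itv.
Qed.

Lemma field_section (w : R -> R) t : bmeas I w -> TT t ->
  mbmeas I (fun v => Complex (w v) 0 *: mean_field a (m t v)).
Proof.
move=> bw Tt.
have sec := mbmeas_section measurable_horizon (@measurable_unit_itv R) (field_mbmeas
  bw) Tt.
exact: sec.
Qed.

Lemma hamiltonian_mbmeas u : I u -> mbmeas TT (effective_hamiltonian P H a W gamma u).
Proof.
move=> Iu; apply: mbmeasD; first exact: mbmeas_cst.
have par := mbmeas_param measurable_horizon (@measurable_unit_itv R) (@unit_itv_finite
  R) (field_mbmeas (graphon_section Iu)).
exact: par.
Qed.

Lemma mean_field_mxnorm1 v t : I v -> 0 <= t <= T ->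
  mxnorm1 (mean_field a (m t v)) <= dimc * A * dimc.
Proof.
move=> Iv tT; rewrite (le_trans (mxnorm1_mean_field _ _))// ler_wpM2l ?mean_mxnorm1//.
by rewrite mulr_ge0 ?norm_ratio_ge0 ?interaction_norm_ge0.
Qed.

Lemma hamiltonian_mxnorm1 u t : I u -> 0 <= t <= T ->
  mxnorm1 (effective_hamiltonian P H a W gamma u t) <=
    dimc * frobnorm H + dimc * A * dimc.
Proof.
move=> Iu tT; rewrite (le_trans (mxnorm1D _ _))// lerD ?mxnorm1_le_frobnorm//.
have bs := field_section (graphon_section Iu) (t := t) tT.
apply: (@le_trans _ _ (\int[mu]_(v in I) mxnorm1 (Complex (W u v) 0 *: mean_field a (m
  t v)))).
  by apply: mxnorm1_mx_integral; [exact: measurable_unit_itv|exact: unit_itv_finite|].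
apply: (@le_trans _ _ (\int[mu]_(v in I) (dimc * A * dimc))).
  apply: ler_Rint; [exact: measurable_unit_itv| exact: unit_itv_finite|
    exact: mbmeas_mxnorm1| exact: bmeas_cst|].
  move=> v Iv; rewrite (le_trans (graphon_weight _ Iu Iv))//.
  exact: mean_field_mxnorm1.
rewrite Rintegral_cst; last exact: measurable_unit_itv.
by rewrite [X in fine X](lebesgue_unit_itv R : _ = 1%:E)/= mulr1.
Qed.

Definition drift u w s := Complex 0 (-1) *:
  commutator (effective_hamiltonian P H a W gamma u s) (left_lim (fun r => gamma u r
    w) s).

Lemma drift_mbmeas u w : I u -> mbmeas TT (drift u w).
Proof.
move=> Iu; apply: mbmeasZ; first exact: cbmeas_cst.
by apply: mbmeas_commutator; [exact: hamiltonian_mbmeas|exact: left_mbmeas_time].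
Qed.

Definition path_equation u w := forall t, 0 <= t <= T ->
  gamma u t w = rho0 + mx_integral mu `[0, t]%classic (drift u w)
    + jump_integral (fun s => N u s w) (fun s =>
        L *m left_lim (fun r => gamma u r w) s *m L^t*
        - left_lim (fun r => gamma u r w) s) t.

Hypothesis pN : forall u, I u -> poisson_process P F (N u).

Lemma path_equation0 u w : path_equation u w -> gamma u 0 w = rho0.
Proof.
move=> /(_ 0); rewrite lexx (ltW T0) => /(_ isT) ->.
have -> : mx_integral mu `[0, 0]%classic (drift u w) = 0.
  by apply/matrixP => i j; rewrite !mxE set_itv1 !Rintegral_set1.
rewrite /jump_integral set_itv_ge ?bnd_simp ?ltxx// fsbig_set0.
by rewrite !addr0.
Qed.

Lemma path_equation_step u w s t : I u -> path_equation u w ->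
  0 <= s -> s < t -> t <= T ->
  (forall r, s < r -> r < t -> jump_size (fun r => N u r w) r = 0 :> R) ->
  gamma u t w = gamma u s w
    + (mx_integral mu `[0, t]%classic (drift u w) - mx_integral mu `[0,
      s]%classic (drift u w))
    + Complex (jump_size (fun r => N u r w) t) 0 *:
      (L *m left_lim (fun r => gamma u r w) t *m L^t* - left_lim (fun r => gamma u r
        w) t).
Proof.
move=> Iu eqn s0 st tT nj.
have t0 : 0 <= t by rewrite (le_trans s0)// ltW.
have sT : s <= T by rewrite (le_trans (ltW st)).
rewrite (eqn t) ?t0// (eqn s) ?s0//.
rewrite (@jump_integral_step R (fun r => N u r w) T _ _ d _ s t)//.
- move: (mx_integral _ _ _) (mx_integral _ _ _) (jump_integral _ _ _) (_ *: _) => p q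
  r z.
  by apply/matrixP => i j; rewrite !mxE; ring.
- by move=> r r0; exact: (poisson_right (pN Iu)).
- by move=> r r0; exact: (poisson_left (pN Iu)).
Qed.

End one_solution.

(** * Two solutions along one path *)

Section two_solutions.
Variables (R : realType) (d : nat) (disp : measure_display)
  (Omega : measurableType disp) (P : probability Omega R)
  (F : R -> set (set Omega)) (N : R -> R -> Omega -> nat) (T : R)
  (L H : 'M[R[i]]_d) (a : 'I_d -> 'I_d -> 'I_d -> 'I_d -> R[i])
  (rho0 : 'M[R[i]]_d) (W1 W2 : R -> R -> R) (gamma1 gamma2 : R -> R -> Omega ->
    'M[R[i]]_d).
Hypotheses (T0 : 0 < T) (UL : L \is unitarymx) (uF : usual_filtration P F).
Hypotheses (gW1 : graphon W1) (gW2 : graphon W2).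
Hypothesis sol1 : solution P F N T L H a rho0 W1 gamma1.
Hypothesis sol2 : solution P F N T L H a rho0 W2 gamma2.
Hypothesis pN : forall u, unit_itv u -> poisson_process P F (N u).
Notation mu := (@lebesgue_measure R).
Notation I := (@unit_itv R).
Notation TT := (`[0, T]%classic : set R).
Notation dimc := (@norm_ratio R d).
Notation m1 := (mean_left P gamma1).
Notation m2 := (mean_left P gamma2).
Notation A := (interaction_norm a).

Definition mean_gap t v := mxnorm1 (m1 t v - m2 t v).
Definition total_gap t := \int[mu]_(v in I) mean_gap t v.
Definition graphon_gap u t := mxnorm1 (mx_integral mu I
  (fun v => Complex (W1 u v - W2 u v) 0 *: mean_field a (m2 t v))).
(** Bounds the difference of the two effective Hamiltonians at label [u]; it
    involves the solutions only through their expectations. *)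
Definition forcing u t := dimc * A * total_gap t + graphon_gap u t.

Lemma mean_gap_bmeas : bmeas (TT `*` I) (fun p => mean_gap p.1 p.2).
Proof.
apply: mbmeas_mxnorm1; apply: mbmeasB.
  exact: (mean_mbmeas T0 uF sol1).
exact: (mean_mbmeas T0 uF sol2).
Qed.

Lemma total_gap_bmeas : bmeas TT total_gap.
Proof.
have par := bmeas_paramR (measurable_horizon T) (@measurable_unit_itv R)
  (@unit_itv_finite R) mean_gap_bmeas.
exact: par.
Qed.

Lemma mean_gap_section t : TT t -> bmeas I (mean_gap t).
Proof.
move=> Tt; have sec := bmeas_section1 (measurable_horizon T) (@measurable_unit_itv R)
  mean_gap_bmeas Tt.
exact: sec.
Qed.

Lemma graphon_diff_bmeas : bmeas (I `*` I) (fun p => W1 p.1 p.2 - W2 p.1 p.2).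
Proof. by apply: bmeasB; exact: graphon_bmeas. Qed.

Lemma graphon_gap_bmeas : bmeas (I `*` TT) (fun p => graphon_gap p.1 p.2).
Proof.
have mIT : measurable (I `*` TT) by apply: measurableX;
  [exact: measurable_unit_itv| exact: measurable_horizon].
have bw : mbmeas ((I `*` TT) `*` I) (fun q : (R * R) * R =>
    Complex (W1 q.1.1 q.2 - W2 q.1.1 q.2) 0 *: mean_field a (m2 q.1.2 q.2)).
  apply: mbmeasZ.
    split; last exact: bmeas_cst.
    apply: (@bmeas_comp R _ _ ((R * R) * R)%type (R * R)%type ((I `*` TT) `*` I) (I
      `*` I)
      (fun q => (q.1.1, q.2)) (fun p => W1 p.1 p.2 - W2 p.1 p.2)).
    - by apply: measurableX; exact: measurable_unit_itv.
    - apply/measurable_fun_pairP; split; last exact: measurable_snd.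
      exact: measurableT_comp measurable_fst measurable_fst.
    - by move=> [[u t] v] [[/= ? ?] ?].
    - exact: graphon_diff_bmeas.
  apply: mbmeas_mean_field.
  apply: (@mbmeas_comp R d _ _ ((R * R) * R)%type (R * R)%type ((I `*` TT) `*` I) (TT
    `*` I)
      (fun q => (q.1.2, q.2)) (fun p => m2 p.1 p.2)).
  - exact: measurable_horizonX.
  - apply/measurable_fun_pairP; split; last exact: measurable_snd.
    exact: measurableT_comp measurable_snd measurable_fst.
  - by move=> [[u t] v] [[/= ? ?] ?].
  - exact: (mean_mbmeas T0 uF sol2).
have par := mbmeas_param mIT (@measurable_unit_itv R) (@unit_itv_finite R) bw.
exact: (mbmeas_mxnorm1 par).
Qed.

Lemma forcing_bmeas : bmeas (I `*` TT) (fun p => forcing p.1 p.2).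
Proof.
apply: bmeasD; last exact: graphon_gap_bmeas.
apply: bmeasM; first exact: bmeas_cst.
by apply: (bmeas_snd _ (measurable_horizon T)); exact: total_gap_bmeas.
Qed.

Lemma forcing_section u : I u -> bmeas TT (forcing u).
Proof.
move=> Iu; have sec := bmeas_section1 (@measurable_unit_itv R) (measurable_horizon T)
  forcing_bmeas Iu.
exact: sec.
Qed.

Lemma total_gap_ge0 t : 0 <= total_gap t.
Proof. by apply: Rintegral_ge0 => v _; exact: mxnorm1_ge0. Qed.

Lemma forcing_ge0 u t : 0 <= forcing u t.
Proof.
rewrite addr_ge0 ?mxnorm1_ge0// mulr_ge0 ?total_gap_ge0//.
by rewrite mulr_ge0 ?norm_ratio_ge0 ?interaction_norm_ge0.
Qed.

(** Insert the mean field of the second solution weighted by the first graphon. *)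
Lemma hamiltonian_gap u t : I u -> TT t ->
  mxnorm1 (effective_hamiltonian P H a W1 gamma1 u t -
           effective_hamiltonian P H a W2 gamma2 u t) <= forcing u t.
Proof.
move=> Iu Tt.
have bd1 : mbmeas I (fun v => Complex (W1 u v) 0 *: mean_field a (m1 t v)).
  exact: (field_section T0 uF sol1 (graphon_section gW1 Iu) Tt).
have bd2 : mbmeas I (fun v => Complex (W2 u v) 0 *: mean_field a (m2 t v)).
  exact: (field_section T0 uF sol2 (graphon_section gW2 Iu) Tt).
have bd12 : mbmeas I (fun v => Complex (W1 u v) 0 *: mean_field a (m2 t v)).
  exact: (field_section T0 uF sol2 (graphon_section gW1 Iu) Tt).
have -> : effective_hamiltonian P H a W1 gamma1 u t -
          effective_hamiltonian P H a W2 gamma2 u t =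
  mx_integral mu I (fun v => Complex (W1 u v) 0 *: mean_field a (m1 t v) -
                             Complex (W1 u v) 0 *: mean_field a (m2 t v)) +
  mx_integral mu I (fun v => Complex (W1 u v - W2 u v) 0 *: mean_field a (m2 t v)).
  rewrite (mx_integralBR (@measurable_unit_itv R) (@unit_itv_finite R) bd1 bd12).
  have -> : mx_integral mu I (fun v => Complex (W1 u v - W2 u v) 0 *: mean_field a (m2
    t v)) =
     mx_integral mu I (fun v => Complex (W1 u v) 0 *: mean_field a (m2 t v) -
                             Complex (W2 u v) 0 *: mean_field a (m2 t v)).
    apply: eq_mx_integral => v _; rewrite -scalerBl; congr (_ *: _).
    by apply/eqP; rewrite eq_complex/= subr0 !eqxx.
  rewrite (mx_integralBR (@measurable_unit_itv R) (@unit_itv_finite R) bd12 bd2).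
  have gen (h p q r : 'M[R[i]]_d) : h + p - (h + q) = p - r + (r - q).
    by apply/matrixP => i j; rewrite !mxE; ring.
  exact: gen.
have bd := mbmeasB bd1 bd12.
rewrite (le_trans (mxnorm1D _ _))// lerD2r /total_gap.
apply: (@le_trans _ _ (\int[mu]_(v in I) mxnorm1 (Complex (W1 u v) 0 *: mean_field a
  (m1 t v) -
                             Complex (W1 u v) 0 *: mean_field a (m2 t v)))).
  exact: (mxnorm1_mx_integralR (@measurable_unit_itv R) (@unit_itv_finite R) bd).
rewrite -RintZ; [| exact: measurable_unit_itv| exact: unit_itv_finite|
  exact: mean_gap_section].
apply: ler_RintR; [exact: measurable_unit_itv| exact: unit_itv_finite|
  exact: (mbmeas_mxnorm1 bd)| |].
- by apply: bmeasM; [exact: bmeas_cst|exact: mean_gap_section].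
- move=> v Iv; rewrite -scalerBr (le_trans (graphon_weight gW1 _ Iu Iv))//.
  by rewrite -mean_fieldB mxnorm1_mean_field.
Qed.

Notation left1 u w := (left_lim (fun r => gamma1 u r w)).
Notation left2 u w := (left_lim (fun r => gamma2 u r w)).

(** A bound on the effective Hamiltonian that is uniform in label and time. *)
Definition hamiltonian_const (h A0 : R) : R := dimc * h + dimc * A0 * dimc.
Notation k0 := (hamiltonian_const (frobnorm H) A).

Lemma hamiltonian_const_ge0 : 0 <= k0.
Proof.
by rewrite /hamiltonian_const addr_ge0 ?mulr_ge0 ?norm_ratio_ge0 ?interaction_norm_ge0
  ?frobnorm_ge0.
Qed.

Definition left_gap u w t := mxnorm1 (left1 u w t - left2 u w t).

Lemma left_gap_bmeas u w : I u -> bmeas TT (left_gap u w).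
Proof.
move=> Iu; apply: mbmeas_mxnorm1; apply: mbmeasB.
  exact: (left_mbmeas_time T0 sol1 w Iu).
exact: (left_mbmeas_time T0 sol2 w Iu).
Qed.

(** Its first summand carries the distance itself, fed back through Gronwall; the
    second is deterministic. *)
Definition rate u w t := 2 * k0 * left_gap u w t + 2 * dimc * forcing u t.

Lemma rate_bmeas u w : I u -> bmeas TT (rate u w).
Proof.
move=> Iu; apply: bmeasD; apply: bmeasM; try exact: bmeas_cst.
  exact: left_gap_bmeas.
exact: forcing_section.
Qed.

Lemma rate_ge0 u w t : 0 <= rate u w t.
Proof.
by rewrite addr_ge0// mulr_ge0 ?mxnorm1_ge0 ?forcing_ge0// mulr_ge0
  ?hamiltonian_const_ge0 ?norm_ratio_ge0.
Qed.

Notation drift1 := (drift P H a W1 gamma1).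
Notation drift2 := (drift P H a W2 gamma2).

Lemma drift_gap u w t : I u -> TT t ->
  mxnorm1 (drift1 u w t - drift2 u w t) <= rate u w t.
Proof.
move=> Iu Tt; rewrite /drift -scalerBr (le_trans (mxnorm1Z _ _))//.
rewrite /cnorm1/= normr0 add0r normrN1 mul1r.
rewrite commutatorB (le_trans (mxnorm1D _ _))// lerD//.
  rewrite (le_trans (mxnorm1_commutator _ _))// -mulrA ler_wpM2l//.
  rewrite ler_wpM2r ?mxnorm1_ge0//.
  exact: (hamiltonian_mxnorm1 T0 uF gW1 sol1).
rewrite (le_trans (mxnorm1_commutator _ _))// -mulrA ler_wpM2l// mulrC.
rewrite ler_pM ?mxnorm1_ge0//; last exact: hamiltonian_gap.
exact: (left_mxnorm1 sol2).
Qed.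

Notation Phi u t := (\int[mu]_(s in `[0, t]) forcing u s).
Notation V u w t := (\int[mu]_(s in `[0, t]) rate u w s).

Definition simple_path u w := forall s, 0 < s <= T ->
  jump_size (fun r => N u r w) s = 0 :> R \/ jump_size (fun r => N u r w) s = 1 :> R.

Section path.
Variables (u : R) (w : Omega).
Hypotheses (Iu : I u).
Hypothesis path1 : path_equation P N T L H a rho0 W1 gamma1 u w.
Hypothesis path2 : path_equation P N T L H a rho0 W2 gamma2 u w.
Hypothesis simple : simple_path u w.

Let delta t := gamma1 u t w - gamma2 u t w.
Let ldelta t := left1 u w t - left2 u w t.

Let ldeltaP t e : 0 < t -> t <= T -> 0 < e -> exists2 r, 0 < r &
  forall s, t - r < s -> s < t -> 0 <= s -> frobnorm (delta s - ldelta t) < e.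
Proof.
move=> t0 tT e0; have e2 : 0 < e / 2 by rewrite divr_gt0.
have [r1 r10 H1] := left_limP (solution_cadlag sol1 w Iu) t0 tT e2.
have [r2 r20 H2] := left_limP (solution_cadlag sol2 w Iu) t0 tT e2.
exists (Num.min r1 r2); first by rewrite lt_min r10.
move=> s rs st _.
have rs1 : t - r1 < s by apply: le_lt_trans rs; rewrite lerB// ge_min lexx.
have rs2 : t - r2 < s by apply: le_lt_trans rs; rewrite lerB// ge_min lexx orbT.
have -> : delta s - ldelta t =
    (gamma1 u s w - left1 u w t) - (gamma2 u s w - left2 u w t).
  by rewrite /delta /ldelta !opprD !opprK addrACA.
rewrite (le_lt_trans (frobnormD _ _))// frobnormN.
rewrite (_ : e = e / 2 + e / 2); last by rewrite -splitr.
by rewrite ltrD ?H1 ?H2.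
Qed.

Let drift_increment_gap s t : 0 <= s -> s <= t -> t <= T ->
  frobnorm ((mx_integral mu `[0, t]%classic (drift1 u w) - mx_integral mu `[0,
    t]%classic (drift2 u w))
   - (mx_integral mu `[0, s]%classic (drift1 u w) - mx_integral mu `[0,
     s]%classic (drift2 u w)))
  <= V u w t - V u w s.
Proof.
move=> s0 st tT.
have b1 := drift_mbmeas T0 uF gW1 sol1 w Iu.
have b2 := drift_mbmeas T0 uF gW2 sol2 w Iu.
have sub := subset_oc_cc s0 tT.
have fin : (mu `]s, t]%classic < +oo)%E by exact: itvoc_finite.
have b1s : mbmeas `]s, t]%classic (drift1 u w) by exact: mbmeasS b1.
have b2s : mbmeas `]s, t]%classic (drift2 u w) by exact: mbmeasS b2.
have bd := mbmeasB b1s b2s.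
have e1 := mx_integralcB b1 s0 st tT; have e2 := mx_integralcB b2 s0 st tT.
have e12 := mx_integralBR (measurable_itv _) fin b1s b2s.
have subACA (p q r z y1 y2 : 'M[R[i]]_d) : p - r = y1 -> q - z = y2 ->
    (p - q) - (r - z) = y1 - y2.
  by move=> <- <-; rewrite !opprD !opprK addrACA.
rewrite (subACA _ _ _ _ _ _ e1 e2) -e12.
rewrite (RintcB (rate_bmeas w Iu) s0 st tT).
apply: (le_trans (frobnorm_le_mxnorm1 _)).
apply: (@le_trans _ _ (\int[mu]_(r in `]s, t]) mxnorm1 (drift1 u w r - drift2 u w r))).
  exact: (mxnorm1_mx_integralR (measurable_itv _) fin bd).
apply: (ler_RintR (measurable_itv _) fin (mbmeas_mxnorm1 bd)).
- exact: bmeasS (rate_bmeas w Iu).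
- by move=> r /sub Tr; exact: drift_gap.
Qed.

Lemma delta_le_V t : 0 <= t <= T -> frobnorm (delta t) <= V u w t.
Proof.
have [_ [c rc]] := rate_bmeas w Iu.
have c0 : 0 <= c.
  by apply: le_trans (normr_ge0 _) (rc 0 _); rewrite /= in_itv/= lexx ltW.
pose D t := mx_integral mu `[0, t]%classic (drift1 u w) - mx_integral mu `[0,
  t]%classic (drift2 u w).
apply: (@unitary_jump_bound R (fun r => N u r w) T _ _ d L delta ldelta D
  (fun t => V u w t) c) => //.
- by move=> r r0; exact: (poisson_right (pN Iu)).
- by move=> r r0; exact: (poisson_left (pN Iu)).
- move=> s s' s0 st tT nj; rewrite /delta.
  rewrite (path_equation_step pN Iu path1 s0 st tT nj).
  rewrite (path_equation_step pN Iu path2 s0 st tT nj).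
  rewrite /ldelta /D mulmxBr mulmxBl.
  have gen (g g' p p' q q' x x' l l' : 'M[R[i]]_d) z :
      g + (p - q) + z *: (x - l) - (g' + (p' - q') + z *: (x' - l')) =
      g - g' + ((p - p') - (q - q')) + z *: (x - x' - (l - l')).
    by apply/matrixP => i j; rewrite !mxE; ring.
  exact: gen.
- by move=> s s' s0 st tT; exact: (Rintc_increment (rate_bmeas w Iu) rc s0 st tT).
- by rewrite /delta (path_equation0 T0 path1) (path_equation0 T0 path2) subrr.
- by rewrite set_itv1 Rintegral_set1.
Qed.

(** The drift involves left limits, so Gronwall's inequality is run on the left
    limits of the difference rather than on the difference itself. *)
Lemma ldelta_le_V t : 0 <= t <= T -> frobnorm (ldelta t) <= V u w t.
Proof.
move=> /andP[]; rewrite le_eqVlt => /predU1P[<- _|t0 tT].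
  have := @delta_le_V 0; rewrite lexx (ltW T0) => /(_ isT).
  by rewrite /ldelta /left_lim ltxx.
apply/ler_addgt0Pr => e e0.
have [r r0 Hr] := ldeltaP t0 tT e0.
pose s := Num.max 0 (t - r / 2).
have st : s < t by rewrite gt_max t0/=; lra.
have rs : t - r < s by rewrite lt_max; apply/orP; right; lra.
have s0 : 0 <= s by rewrite le_max lexx.
have := Hr _ rs st s0; rewrite frobnormB => h.
have ds : frobnorm (delta s) <= V u w s by apply: delta_le_V;
  rewrite s0 (le_trans (ltW st)).
have Vst : V u w s <= V u w t.
  by apply: Rintc_mono (rate_bmeas w Iu) _ s0 (ltW st) tT => r' _; exact: rate_ge0.
rewrite -[ldelta t](subrK (delta s)) (le_trans (frobnormD _ _))// addrC.
by rewrite lerD ?(le_trans ds)// ltW.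
Qed.

(** What Gronwall's inequality leaves in front of the integral of the forcing, for
    the left limits and then for the paths themselves. *)
Definition growth (k : R) : R := 2 * (2 * dimc ^+ 2) * expR (2 * (2 * dimc * k + 1) *
  T).
Definition path_const (k : R) : R := 2 * k * (growth k * T) + 2 * dimc.

Lemma V_le_Phi t : 0 <= t <= T -> V u w t <= path_const k0 * Phi u t.
Proof.
move=> /andP[]; rewrite le_eqVlt => /predU1P[<- _|t0 tT].
  by rewrite set_itv1 !Rintegral_set1 mulr0.
have subt : `[0, t]%classic `<=` TT by exact: subset_cc_cc.
have bl s : s <= t -> bmeas `[0, s]%classic (left_gap u w).
  move=> st; apply: bmeasS (left_gap_bmeas w Iu) => //.
  by apply: subset_cc_cc; exact: le_trans tT.
have bf s : s <= t -> bmeas `[0, s]%classic (forcing u).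
  move=> st; apply: bmeasS (forcing_section Iu) => //.
  by apply: subset_cc_cc; exact: le_trans tT.
have VE s : s <= t -> V u w s =
    2 * k0 * (\int[mu]_(r in `[0, s]) left_gap u w r) + 2 * dimc * Phi u s.
  move=> st; rewrite /rate RintD//; [|exact: itvcc_finite| |].
  - by rewrite !RintZ//; try exact: itvcc_finite; [exact: bf|exact: bl].
  - by apply: bmeasM; [exact: bmeas_cst|exact: bl].
  - by apply: bmeasM; [exact: bmeas_cst|exact: bf].
have Phimono s : 0 <= s -> s <= t -> Phi u s <= Phi u t.
  by move=> s0 st; apply: Rintc_mono (forcing_section Iu) _ s0 st tT => r _;
    exact: forcing_ge0.
have Phi0 : 0 <= Phi u t by apply: Rintegral_ge0 => r _; exact: forcing_ge0.
have gr s : 0 <= s <= t -> left_gap u w s <=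
    2 * (2 * dimc ^+ 2 * Phi u t) * expR (2 * (2 * dimc * k0 + 1) * s).
  move: s; apply: gronwall => //.
  - by rewrite ltr_wpDl// mulr_ge0 ?hamiltonian_const_ge0// mulr_ge0 ?norm_ratio_ge0.
  - exact: bl.
  - by move=> s _; exact: mxnorm1_ge0.
  - move=> s /andP[s0 st].
    rewrite (le_trans (mxnorm1_le_frobnorm _))// -/dimc.
    have sT : 0 <= s <= T by rewrite s0 (le_trans st).
    rewrite (le_trans (ler_wpM2l (norm_ratio_ge0 _ _) (ldelta_le_V sT)))// VE//.
    have I0 : 0 <= \int[mu]_(r in `[0, s]) left_gap u w r.
      by apply: Rintegral_ge0 => r _; exact: mxnorm1_ge0.
    have P1 : dimc * (2 * dimc * Phi u s) <= 2 * dimc ^+ 2 * Phi u t.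
      rewrite (_ : dimc * (2 * dimc * Phi u s) = 2 * dimc ^+ 2 * Phi u s); last by ring.
      by rewrite ler_wpM2l ?Phimono// mulr_ge0// exprn_ge0// norm_ratio_ge0.
    rewrite mulrDr.
    rewrite (_ : dimc * (2 * k0 * _) = 2 * dimc * k0 * \int[mu]_(r in `[0,
      s]) left_gap u w r); last by ring.
    by rewrite addrC lerD// ler_wpM2r// lerDl.
have Il : \int[mu]_(r in `[0, t]) left_gap u w r <= growth k0 * T * Phi u t.
  apply: (@le_trans _ _ (\int[mu]_(r in `[0, t]) (growth k0 * Phi u t))).
    apply: ler_Rint => //; [exact: itvcc_finite|exact: bl|exact: bmeas_cst|].
    move=> r; rewrite /= in_itv/= => /andP[r0 rt].
    rewrite (le_trans (gr r _)) ?r0//.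
    have dPhi0 : 0 <= 2 * (2 * dimc ^+ 2 * Phi u t).
      by rewrite mulr_ge0// mulr_ge0// mulr_ge0// exprn_ge0// norm_ratio_ge0.
    rewrite [leRHS](_ : _ = 2 * (2 * dimc ^+ 2 * Phi u t) *
      expR (2 * (2 * dimc * k0 + 1) * T)); last by rewrite /growth; ring.
    rewrite (ler_wpM2l dPhi0)// ler_expR ler_wpM2l ?(le_trans rt)//.
    by rewrite mulr_ge0// addr_ge0// mulr_ge0 ?hamiltonian_const_ge0// mulr_ge0
      ?norm_ratio_ge0.
  rewrite Rintegral_cst// [X in fine X](lebesgue_itv true false (ltW t0) : _
    = _)/= subr0.
  rewrite [leRHS](_ : _ = growth k0 * Phi u t * T); last by ring.
  by rewrite ler_wpM2l// mulr_ge0// /growth mulr_ge0 ?expR_ge0// !mulr_ge0//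
    exprn_ge0// norm_ratio_ge0.
rewrite VE// [leRHS](_ : _ = 2 * k0 * (growth k0 * T * Phi u t) + 2 * dimc * Phi u t).
  by rewrite lerD2r ler_wpM2l// mulr_ge0 ?hamiltonian_const_ge0.
by rewrite /path_const; ring.
Qed.

Theorem path_bound t : 0 <= t <= T ->
  frobnorm (gamma1 u t w - gamma2 u t w) <= path_const k0 * Phi u t /\
  left_gap u w t <= dimc * (path_const k0 * Phi u t).
Proof.
move=> tT; split; first exact: le_trans (delta_le_V tT) (V_le_Phi tT).
rewrite (le_trans (mxnorm1_le_frobnorm _))// ler_wpM2l ?norm_ratio_ge0//.
exact: le_trans (ldelta_le_V tT) (V_le_Phi tT).
Qed.

End path.
End two_solutions.

(** * Stability with respect to the graphon *)

Section stability.
Variables (R : realType) (d : nat) (disp : measure_display)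
  (Omega : measurableType disp) (P : probability Omega R)
  (F : R -> set (set Omega)) (N : R -> R -> Omega -> nat) (T : R)
  (L H : 'M[R[i]]_d) (a : 'I_d -> 'I_d -> 'I_d -> 'I_d -> R[i])
  (rho0 : 'M[R[i]]_d) (W1 W2 : R -> R -> R) (gamma1 gamma2 : R -> R -> Omega ->
    'M[R[i]]_d).
Hypotheses (T0 : 0 < T) (UL : L \is unitarymx) (uF : usual_filtration P F).
Hypotheses (gW1 : graphon W1) (gW2 : graphon W2).
Hypothesis sol1 : solution P F N T L H a rho0 W1 gamma1.
Hypothesis sol2 : solution P F N T L H a rho0 W2 gamma2.
Hypothesis pN : forall u, unit_itv u -> poisson_process P F (N u).
Notation mu := (@lebesgue_measure R).
Notation I := (@unit_itv R).
Notation TT := (`[0, T]%classic : set R).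
Notation dimc := (@norm_ratio R d).
Notation A := (interaction_norm a).
Notation m1 := (mean_left P gamma1).
Notation m2 := (mean_left P gamma2).
Notation forcing := (@forcing R d disp Omega P a W1 W2 gamma1 gamma2).
Notation total_gap := (@total_gap R d disp Omega P gamma1 gamma2).
Notation graphon_gap := (@graphon_gap R d disp Omega P a W1 W2 gamma2).
Notation mean_gap := (@mean_gap R d disp Omega P gamma1 gamma2).
Notation k0 := (hamiltonian_const d (frobnorm H) A).
Notation pc := (path_const d T k0).

Variable cut : R.
Hypothesis cut_ge0 : 0 <= cut.
Hypothesis cutP : forall B1 B2 : set R,
  measurable B1 -> B1 `<=` I -> measurable B2 -> B2 `<=` I ->
  `|\int[mu]_(u in B1) \int[mu]_(v in B2) (W1 u v - W2 u v)| <= cut.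

Definition gap_const (A0 : R) : R := dimc * (4 * (dimc * A0 * dimc)).

Let dA_ge0 : 0 <= dimc * A.
Proof. by rewrite mulr_ge0 ?norm_ratio_ge0 ?interaction_norm_ge0. Qed.

Lemma gap_const_ge0 : 0 <= gap_const A.
Proof. by rewrite mulr_ge0 ?norm_ratio_ge0// mulr_ge0// mulr_ge0// norm_ratio_ge0. Qed.

Let weight_bmeas (f : R -> R) : bmeas I f ->
  bmeas I (fun u => `|\int[mu]_(v in I) ((W1 u v - W2 u v) * f v)|).
Proof.
move=> bf; apply: bmeas_norm.
have b : bmeas (I `*` I) (fun p => (W1 p.1 p.2 - W2 p.1 p.2) * f p.2).
  apply: bmeasM; first exact: graphon_diff_bmeas.
  by apply: (bmeas_snd _ (@measurable_unit_itv R)).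
have par := bmeas_paramR (@measurable_unit_itv R) (@measurable_unit_itv R)
  (@unit_itv_finite R) b.
exact: par.
Qed.

Lemma graphon_gap_cut t : TT t -> \int[mu]_(u in I) graphon_gap u t <= gap_const A *
  cut.
Proof.
move=> Tt.
pose M := dimc * A * dimc.
have M0 : 0 <= M by rewrite mulr_ge0 ?norm_ratio_ge0.
have bm : mbmeas I (fun v => mean_field a (m2 t v)).
  apply: mbmeas_mean_field.
  have sec := mbmeas_section (measurable_horizon T) (@measurable_unit_itv R)
    (mean_mbmeas T0 uF sol2) Tt.
  exact: sec.
pose q i j u := `|\int[mu]_(v in I) ((W1 u v - W2 u v) * complex.Re (mean_field a (m2
  t v) i j))|
  + `|\int[mu]_(v in I) ((W1 u v - W2 u v) * complex.Im (mean_field a (m2 t v) i j))|.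
have bq i j : bmeas I (q i j).
  by apply: bmeasD; apply: weight_bmeas; [exact: (bm i j).1|exact: (bm i j).2].
have bound i j v : I v -> cnorm1 (mean_field a (m2 t v) i j) <= M.
  move=> Iv; rewrite (le_trans (entry_le_mxnorm1 _ _ _))//.
  exact: (mean_field_mxnorm1 T0 uF sol2).
have qle i j : \int[mu]_(u in I) q i j u <= 2 * (4 * M * cut).
  rewrite RintD; [|exact: measurable_unit_itv|exact: unit_itv_finite| |]; last 2 first.
  - by apply: weight_bmeas; exact: (bm i j).1.
  - by apply: weight_bmeas; exact: (bm i j).2.
  rewrite mulr2n mulrDl mul1r lerD//; apply: cut_weight => //.
  - exact: graphon_diff_bmeas.
  - exact: (bm i j).1.
  - by move=> v Iv; rewrite (le_trans (Re_le_cnorm1 _))// bound.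
  - exact: graphon_diff_bmeas.
  - exact: (bm i j).2.
  - by move=> v Iv; rewrite (le_trans (Im_le_cnorm1 _))// bound.
have -> : \int[mu]_(u in I) graphon_gap u t = \int[mu]_(u in I) (\sum_i \sum_j q i j u).
  apply: eq_Rintegral => u _; rewrite /graphon_gap /mxnorm1.
  apply: eq_bigr => i _; apply: eq_bigr => j _.
  rewrite /cnorm1 mxE /q/=; congr (_ + _); congr (Num.norm _);
    apply: eq_Rintegral => v _.
    by rewrite mxE ReM/= mul0r subr0.
  by rewrite mxE ImM/= mul0r addr0.
rewrite Rintegral_sum; [| exact: measurable_unit_itv| exact: unit_itv_finite|
  by move=> i; apply: bmeas_sum => j; exact: bq].
apply: (@le_trans _ _ (\sum_(i < d) \sum_(j < d) (2 * (4 * M * cut)))).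
  apply: ler_sum => i _; rewrite Rintegral_sum; [| exact: measurable_unit_itv|
    exact: unit_itv_finite| by move=> j; exact: bq].
  by apply: ler_sum => j _; exact: qle.
rewrite !sumr_const card_ord -!mulrnA -[leLHS]mulr_natl natrM le_eqVlt; apply/orP; left.
by apply/eqP; rewrite /gap_const /M /norm_ratio; ring.
Qed.

Let bforcing := forcing_bmeas T0 uF gW1 gW2 sol1 sol2.
Let bforcing_u u (Iu : I u) := forcing_section T0 uF gW1 gW2 sol1 sol2 Iu.

Notation Phi u t := (\int[mu]_(s in `[0, t]) forcing u s).

Lemma paths_good u : I u -> {ae P, forall w,
  [/\ path_equation P N T L H a rho0 W1 gamma1 u w,
      path_equation P N T L H a rho0 W2 gamma2 u w & simple_path N T u w]}.
Proof.
move=> Iu.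
have h1 := solution_eq sol1 Iu; have h2 := solution_eq sol2 Iu.
have h3 := simple_jumps uF (pN Iu) T0.
by apply: filterS3 h1 h2 h3 => w h1 h2 h3; split.
Qed.

(** The pathwise bound is deterministic, so it survives taking expectations. *)
Lemma mean_gap_le t v : TT t -> I v -> mean_gap t v <= dimc * (pc * Phi v t).
Proof.
move=> Tt Iv; have tT : 0 <= t <= T by [].
have b1 := left_mbmeas_omega T0 uF sol1 Iv tT.
have b2 := left_mbmeas_omega T0 uF sol2 Iv tT.
rewrite /mean_gap /mean_left -(mx_integralB _ _ b1 b2)//;
  last exact: probability_finite.
apply: (@le_trans _ _ (\int[P]_w left_gap gamma1 gamma2 v w t)).
  by apply: mxnorm1_mx_integral => //; [exact: probability_finite|exact: mbmeasB].
apply: Rint_ae_le.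
- by apply: mbmeas_mxnorm1; exact: mbmeasB.
- by move=> w; exact: mxnorm1_ge0.
- apply: filterS (paths_good Iv) => w [p1 p2 sp].
  exact: (path_bound T0 UL uF gW1 gW2 sol1 sol2 pN Iv p1 p2 sp tT).2.
Qed.

Lemma forcing_integral t : TT t ->
  \int[mu]_(u in I) forcing u t <= dimc * A * total_gap t + gap_const A * cut.
Proof.
move=> Tt.
have bg : bmeas I (fun u => graphon_gap u t).
  have sec := bmeas_section2 (@measurable_unit_itv R) (measurable_horizon T)
    (graphon_gap_bmeas T0 uF gW1 gW2 sol2) Tt.
  exact: sec.
rewrite /forcing RintD; [| exact: measurable_unit_itv| exact: unit_itv_finite|
  exact: bmeas_cst| exact: bg].
rewrite lerD ?graphon_gap_cut// Rintegral_cst; last exact: measurable_unit_itv.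
by rewrite [X in fine X](lebesgue_unit_itv R : _ = 1%:E)/= mulr1.
Qed.

(** Exchanging the label and time integrals leaves, at each time, the total gap
    plus a multiple of the cut norm. *)
Lemma Phi_integral t : TT t -> \int[mu]_(u in I) Phi u t <=
  dimc * A * (\int[mu]_(s in `[0, t]) total_gap s) + gap_const A * cut * t.
Proof.
move=> Tt; have /andP[t0 tT] : 0 <= t <= T by [].
have sub := subset_cc_cc tT.
have fin := itvcc_finite 0 t.
have mIT : measurable (I `*` TT) by apply: measurableX;
  [exact: measurable_unit_itv| exact: measurable_horizon].
have bf : bmeas (I `*` `[0, t]%classic) (fun p => forcing p.1 p.2).
  by apply: bmeasS bforcing => // -[u s] [/= ? /sub].
rewrite (Rint_swapR (@measurable_unit_itv R) (measurable_itv _) (@unit_itv_finite R)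
  fin bf).
have btot : bmeas `[0, t]%classic total_gap.
  by apply: bmeasS (total_gap_bmeas T0 uF sol1 sol2) => //; exact: measurable_horizon.
apply: (@le_trans _ _ (\int[mu]_(s in `[0, t]) (dimc * A * total_gap s + gap_const A *
  cut))).
  apply: ler_Rint => //.
  - have sw : bmeas (`[0, t]%classic `*` I) (fun p => forcing p.2 p.1).
      apply: (@bmeas_comp R _ _ (R * R)%type (R * R)%type (`[0, t]%classic `*` I)
        (I `*` TT) unstable.swap (fun p => forcing p.1 p.2)) => //.
      + exact: measurable_swap.
      + by move=> [s u] [/= /sub].
    have par := bmeas_paramR (measurable_itv _) (@measurable_unit_itv R)
      (@unit_itv_finite R) sw.
    exact: par.
  - by apply: bmeasD; [apply: bmeasM => //; exact: bmeas_cst|exact: bmeas_cst].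
  - by move=> s /sub Ts; exact: forcing_integral.
rewrite RintD//; last exact: bmeas_cst.
  rewrite RintZ// lerD2l Rintegral_cst//.
  by rewrite [X in fine X](lebesgue_itv true false t0 : _ = _)/= subr0.
by apply: bmeasM => //; exact: bmeas_cst.
Qed.

Definition total_const (pc0 A0 : R) : R :=
  2 * (dimc * pc0 * gap_const A0 * T) * expR (2 * (dimc * pc0 * (dimc * A0) + 1) * T).

Lemma growth_ge0 k : 0 <= growth d T k.
Proof. by rewrite /growth mulr_ge0 ?expR_ge0// !mulr_ge0// exprn_ge0// norm_ratio_ge0.
  Qed.

Lemma path_const_ge0 : 0 <= pc.
Proof.
rewrite /path_const addr_ge0// mulr_ge0 ?norm_ratio_ge0//.
  by rewrite mulr_ge0// hamiltonian_const_ge0.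
by rewrite mulr_ge0 ?growth_ge0// ltW.
Qed.

(** Second use of Gronwall's inequality, now in the deterministic quantity
    [total_gap]. *)
Lemma total_gap_le t : 0 <= t <= T -> total_gap t <= total_const pc A * cut.
Proof.
move=> tT.
have pc0 := path_const_ge0; have gc0 := gap_const_ge0; have dc0 := @norm_ratio_ge0 R d.
have dp0 : 0 <= dimc * pc by rewrite mulr_ge0.
have k2 : 0 <= dimc * pc * (dimc * A) by rewrite mulr_ge0.
have tot0 s : 0 <= total_gap s by exact: total_gap_ge0.
have gr s : 0 <= s <= T -> total_gap s <= 2 * (dimc * pc * gap_const A * cut * T)
    * expR (2 * (dimc * pc * (dimc * A) + 1) * s).
  move: s; apply: gronwall => //.
  - by rewrite ltr_wpDl.
  - exact: (total_gap_bmeas T0 uF sol1 sol2).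
  - move=> s sT; have /andP[s0 sT'] := sT.
    have bPhi : bmeas I (fun v => Phi v s).
      have bf : bmeas (I `*` `[0, s]%classic) (fun p => forcing p.1 p.2).
        apply: bmeasS bforcing; first by apply: measurableX;
          [exact: measurable_unit_itv| exact: measurable_horizon].
        by move=> -[u r] [/= ? /(subset_cc_cc sT')].
      have par := bmeas_paramR (@measurable_unit_itv R) (measurable_itv _)
        (itvcc_finite 0 s) bf.
      exact: par.
    apply: (@le_trans _ _ (\int[mu]_(v in I) (dimc * pc * Phi v s))).
      apply: ler_Rint; [exact: measurable_unit_itv|exact: unit_itv_finite| | |].
      + exact: (mean_gap_section T0 uF sol1 sol2 sT).
      + by apply: bmeasM => //; exact: bmeas_cst.
      + by move=> v Iv; rewrite -mulrA; exact: mean_gap_le.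
    rewrite RintZ; [|exact: measurable_unit_itv|exact: unit_itv_finite|exact: bPhi].
    rewrite (le_trans (ler_wpM2l dp0 (Phi_integral sT)))// mulrDr.
    have Itot : 0 <= \int[mu]_(r in `[0, s]) total_gap r by exact: Rintegral_ge0.
    have : dimc * pc * (gap_const A * cut * s) <= dimc * pc * gap_const A * cut * T.
      rewrite [leRHS](_ : _ = dimc * pc * (gap_const A * cut * T)); last by ring.
      by rewrite ler_wpM2l// ler_wpM2l// mulr_ge0.
    move=> hX; rewrite addrC lerD//.
    rewrite [leLHS](_ : _ = dimc * pc * (dimc * A) * \int[mu]_(r in `[0,
      s]) total_gap r).
      by rewrite ler_wpM2r// lerDl.
    by ring.
rewrite (le_trans (gr _ tT))// /total_const.
rewrite [leRHS](_ : _ = 2 * (dimc * pc * gap_const A * cut * T) *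
  expR (2 * (dimc * pc * (dimc * A) + 1) * T)); last by ring.
have h0 : 0 <= 2 * (dimc * pc * gap_const A * cut * T).
  by have T0' := ltW T0; do 5! [apply: mulr_ge0 => //].
rewrite (ler_wpM2l h0)// ler_expR ler_wpM2l//; last by case/andP: tT.
by rewrite mulr_ge0// addr_ge0.
Qed.

Definition stability_const (pc0 A0 : R) : R :=
  2 * dimc * pc0 * ((dimc * A0 * total_const pc0 A0 + gap_const A0) * T).

Lemma Phi_total : \int[mu]_(u in I) Phi u T <=
  (dimc * A * total_const pc A + gap_const A) * T * cut.
Proof.
have TTT : TT T by rewrite /= in_itv/= lexx ltW.
rewrite (le_trans (Phi_integral TTT))//.
have : \int[mu]_(s in TT) total_gap s <= total_const pc A * cut * T.
  apply: (@le_trans _ _ (\int[mu]_(s in TT) (total_const pc A * cut))).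
    apply: ler_Rint; [exact: measurable_horizon| exact: horizon_finite|
      exact: (total_gap_bmeas T0 uF sol1 sol2)| exact: bmeas_cst|].
    by move=> s Ts; exact: total_gap_le.
  rewrite Rintegral_cst; last exact: measurable_horizon.
  by rewrite [X in fine X](lebesgue_itv true false (ltW T0) : _ = _)/= subr0.
move=> /(ler_wpM2l dA_ge0); lra.
Qed.

(** One of the two factors of the square is bounded by the size of density
    matrices, which keeps the estimate linear. *)
Lemma sup_sqdist_le u w : I u -> 
  path_equation P N T L H a rho0 W1 gamma1 u w ->
  path_equation P N T L H a rho0 W2 gamma2 u w -> simple_path N T u w ->
  (sup_sqdist T gamma1 gamma2 u w <= (2 * dimc * pc * Phi u T)%:E)%E.
Proof.
move=> Iu p1 p2 sp; apply: ge_ereal_sup => _ [t Tt <-]; rewrite lee_fin.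
have /andP[t0 tT] : 0 <= t <= T by [].
have [pb _] := path_bound T0 UL uF gW1 gW2 sol1 sol2 pN Iu p1 p2 sp (t := t) Tt.
have fd : frobnorm (gamma1 u t w - gamma2 u t w) <= 2 * dimc.
  rewrite (le_trans (frobnormD _ _))// frobnormN mulr2n mulrDl mul1r lerD//;
    rewrite (le_trans (frobnorm_le_mxnorm1 _))//.
    exact: (solution_mxnorm1 sol1).
  exact: (solution_mxnorm1 sol2).
have Pm : Phi u t <= Phi u T.
  by apply: Rintc_mono (bforcing_u Iu) _ t0 tT (lexx T) => r _; exact: forcing_ge0.
rewrite expr2 [leRHS](_ : _ = 2 * dimc * (pc * Phi u T)); last by ring.
apply: ler_pM; [exact: frobnorm_ge0|exact: frobnorm_ge0|exact: fd|].
exact: le_trans pb (ler_wpM2l path_const_ge0 Pm).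
Qed.

Hypothesis exch : exchangeable_integral P (sup_sqdist T gamma1 gamma2).

Theorem graphon_stability :
  (\int[P]_w \int[mu]_(u in I) sup_sqdist T gamma1 gamma2 u w
    <= (stability_const pc A * cut)%:E)%E.
Proof.
have sup0 u w : (0 <= sup_sqdist T gamma1 gamma2 u w)%E.
  apply: (@le_trans _ _ (frobnorm (gamma1 u 0 w - gamma2 u 0 w) ^+ 2)%:E).
    by rewrite lee_fin sqr_ge0.
  by apply: ereal_sup_ubound; exists 0 => //=; rewrite in_itv/= lexx ltW.
have c0 : 0 <= 2 * dimc * pc by rewrite mulr_ge0 ?path_const_ge0// mulr_ge0
  ?norm_ratio_ge0.
have Phi0 u : 0 <= Phi u T by apply: Rintegral_ge0 => r _; exact: forcing_ge0.
have bPhi : bmeas I (fun u => 2 * dimc * pc * Phi u T).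
  apply: bmeasM; first exact: bmeas_cst.
  have par := bmeas_paramR (@measurable_unit_itv R) (measurable_horizon T)
    (horizon_finite T) bforcing.
  exact: par.
rewrite (exchangeable_eq exch).
apply: (@le_trans _ _ (\int[mu]_(u in I) (2 * dimc * pc * Phi u T)%:E)%E).
  apply: ge0_le_integral.
  - exact: measurable_unit_itv.
  - by move=> u _; apply: integral_ge0 => w _; exact: sup0.
  - exact: (exchangeable_meas_int_w exch).
  - by apply/measurable_EFinP; exact: bPhi.1.
  - move=> u Iu.
    apply: (@le_trans _ _ (\int[P]_w (cst (2 * dimc * pc * Phi u T)%:E) w)%E).
      apply: ae_ge0_le_integral => //.
      + exact: (exchangeable_meas_w exch).
      + by move=> w _; rewrite lee_fin mulr_ge0.
      + by apply: filterS (paths_good Iu) => w [p1 p2 sp] _; exact: sup_sqdist_le.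
    by rewrite integral_cst// [X in (_ * X)%E](probability_setT P : _ = 1%E) mule1.
have fin : (\int[mu]_(u in I) (2 * dimc * pc * Phi u T)%:E)%E \is a fin_num.
  apply: integrable_fin_num; first exact: measurable_unit_itv.
  by apply: bmeas_integrable; [exact: measurable_unit_itv| exact: unit_itv_finite|
    exact: bPhi].
rewrite -(fineK fin) lee_fin -/(Rintegral _ _ _).
rewrite RintZ; [|exact: measurable_unit_itv|exact: unit_itv_finite|]; last first.
  have par := bmeas_paramR (@measurable_unit_itv R) (measurable_horizon T)
    (horizon_finite T) bforcing.
  exact: par.
rewrite (le_trans (ler_wpM2l c0 Phi_total))// /stability_const le_eqVlt; apply/orP;
  left.
by apply/eqP; ring.
Qed.

End stability.

Theorem theorem4 (R : realType) (d : nat) (d_gt0 : (0 < d)%N) :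
  exists C : R -> R -> R -> R -> R,
  forall (T : R) (L H : 'M[R[i]]_d)
    (a : 'I_d -> 'I_d -> 'I_d -> 'I_d -> R[i]) (rho0 : 'M[R[i]]_d)
    (disp : measure_display) (Omega : measurableType disp)
    (P : probability Omega R) (F : R -> set (set Omega))
    (N : R -> R -> Omega -> nat) (W1 W2 : R -> R -> R)
    (gamma1 gamma2 : R -> R -> Omega -> 'M[R[i]]_d),
  0 < T ->
  L \is unitarymx ->
  H = H^t* ->
  interaction_kernel a ->
  density rho0 ->
  usual_filtration P F ->
  (forall u, unit_itv u -> poisson_process P F (N u)) ->
  graphon W1 ->
  graphon W2 ->
  solution P F N T L H a rho0 W1 gamma1 ->
  solution P F N T L H a rho0 W2 gamma2 ->
  exchangeable_integral P (sup_sqdist T gamma1 gamma2) ->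
  (\int[P]_w \int[lebesgue_measure]_(u in unit_itv)
      sup_sqdist T gamma1 gamma2 u w
    <= (C T (frobnorm H) (interaction_norm a) (frobnorm L))%:E
       * cut_norm (fun u v => (W1 u v - W2 u v)%R))%E.
Proof.
exists (fun T h A _ => stability_const d T (path_const d T (hamiltonian_const d h A))
  A).
move=> T L H a rho0 disp Omega P F N W1 W2 gamma1 gamma2 T0 UL _ _ _ uF pN gW1 gW2
  sol1 sol2 exch.
have [k [k0 -> kP]] := @cut_norm_spec R (fun u v => W1 u v - W2 u v)
  (graphon_diff_bmeas gW1 gW2).
rewrite -EFinM.
exact: (graphon_stability T0 UL uF gW1 gW2 sol1 sol2 pN k0 kP exch).
Qed.
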